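(* The controller gain $K(\Delta) := W(\Delta)\,Y^{-1}(\Delta)$ (with control law $u = K(\Delta)x(t,\Delta)$) minimizes the cost $$\min_{u}\ \mathbf{E}\left[\int_0^\infty \left(x^T Q x + u^T R u\right)dt\right]$$ for the system $\dot x = A(\Delta)x + B(\Delta)u$ if there exist matrix functions $Y(\Delta)=Y^T(\Delta)>0$ in $\mathbb{R}^{n\times n}$ and $W(\Delta)\in\mathbb{R}^{m\times n}$ which are the solutions of the optimization problem $$\max\ \mathrm{tr}\;\mathbf{E}[Y(\Delta)]$$ subject to $$\mathbf{E}\left[\mathrm{sym}\left(\mathcal{Y}\Phi_n A^T\Phi_n^T + \mathcal{W}^T\Phi_m B^T\Phi_n^T\right) + \mathcal{Y}\Phi_n Q\Phi_n^T\mathcal{Y}\right] + \mathbf{E}\left[\mathcal{W}^T\Phi_m R\,\Phi_m^T\mathcal{W}\right]\le 0,$$ where $\mathcal{Y} := I_{N+1}\otimes Y(\Delta)$, $\mathcal{W} := I_{N+1}\otimes W(\Delta)$, and $\mathrm{sym}(X) := X + X^T$.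
   Context: Setting. $\Delta\in\mathbb{R}^d$ is a random vector (not varying in time) with joint probability density $f_\Delta$ on its domain $\mathcal{D}_\Delta$; $\mathbf{E}[\cdot]$ denotes expectation with respect to $f_\Delta$. The system is $\dot x = A(\Delta)x + B(\Delta)u$ with $A(\Delta)\in\mathbb{R}^{n\times n}$, $B(\Delta)\in\mathbb{R}^{n\times m}$, solution $x = x(t,\Delta)\in\mathbb{R}^n$, and given initial state $x(0)=x_0$ without uncertainty. Controls are parameter-dependent state feedbacks $u = K(\Delta)x(t,\Delta)$ with $K(\Delta)\in\mathbb{R}^{m\times n}$. $Q\in\mathbb{R}^{n\times n}$ and $R\in\mathbb{R}^{m\times m}$ are the symmetric positive semidefinite state and control weights. Polynomial chaos basis. $\{\phi_i\}_{i\ge 0}$ is a family of polynomials in $\Delta$ forming an orthogonal basis of $\mathcal{L}_2$ with respect to $f_\Delta$, i.e. $\mathbf{E}[\phi_i\phi_j]=0$ for $i\ne j$. Put $\Phi(\Delta) := (\phi_0(\Delta),\dots,\phi_N(\Delta))^T$ and $\Phi_k(\Delta) := \Phi(\Delta)\otimes I_k$ for $k=n,m$, where $I_k$ is the $k\times k$ identity and $\otimes$ is the Kronecker product. In this statement the expansion is the exact, infinite-term one: $N=\infty$, so that $\Phi=(\phi_0,\phi_1,\dots)^T$, $I_{N+1}$ is the identity on the index set $\{0,1,2,\dots\}$, and ''$\le 0$'' means negative semidefiniteness of the corresponding quadratic form on coefficient vectors $z_{pc}=(z_0,z_1,\dots)$, $z_i\in\mathbb{R}^n$, of second-order processes $\sum_{i\ge0}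 z_i\phi_i(\Delta)=\Phi_n^T z_{pc}$. For symmetric matrices, $>0$ means positive definite. The arguments $\Delta$ of $A,B,\Phi_n,\Phi_m$ are suppressed.
   Formalization: The minimum is taken over measurable state feedbacks u = K(Δ)x that drive x(t,Δ) to 0 for almost every Δ; over all feedbacks the claim fails for semidefinite Q (A=B=R=1, Q=0: K=-2 costs 2x0², u=0 costs 0). *)

(* Defs.v *)
From HB Require Import structures.
From mathcomp Require Import all_boot all_order all_algebra.
From mathcomp Require Import all_classical all_reals all_analysis.
From mathcomp Require mpoly.

(** MathComp-Analysis, over an arbitrary [R : realType]. *)

Set Implicit Arguments.
Unset Strict Implicit.
Unset Printing Implicit Defensive.

Import Order.TTheory GRing.Theory Num.Theory.
Import numFieldNormedType.Exports.

Local Open Scope classical_set_scope.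
Local Open Scope ring_scope.

Section RandomVector.
Context (R : realType) (dO : measure_display) (Omega : measurableType dO).
Context (P : probability Omega R) (d : nat).
Context (Delta : {mfun Omega >-> d.-tuple R}) (D : set (d.-tuple R)).

(** On nonnegative measurable functions this is the integral over [R^d]
    (Tonelli). *)
Fixpoint iterated_integral (k : nat) : (k.-tuple R -> \bar R) -> \bar R :=
  match k with
  | 0 => fun g => g [tuple]
  | k'.+1 => fun g =>
      (\int[lebesgue_measure]_(s in [set: R])
          iterated_integral (fun v : k'.-tuple R => g [tuple of s :: v]))%E
  end.

(** [D] contains all the values of [Delta]; what functions of the parameter do
    outside [D] is irrelevant everywhere below. *)
Definition joint_density (f : d.-tuple R -> R) : Prop :=
  [/\ measurable D,
      forall w, D (Delta w),
      measurable_fun D f,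
      forall v, D v -> 0 <= f v
    & forall S : set (d.-tuple R), measurable S ->
        P (Delta @^-1` S)
        = iterated_integral (fun v => (f v * \1_(D `&` S) v)%:E)].

Definition expect (g : d.-tuple R -> R) : \bar R := ('E_P[g \o Delta])%E.

Definition has_expect (g : d.-tuple R -> R) : Prop :=
  P.-integrable [set: Omega] (EFin \o (g \o Delta)).

Definition mx_measurable (p q : nat) (M : d.-tuple R -> 'M[R]_(p, q)) : Prop :=
  forall i j, measurable_fun D (fun v => M v i j).

Definition mx_has_expect (p q : nat) (M : d.-tuple R -> 'M[R]_(p, q)) : Prop :=
  forall i j, has_expect (fun v => M v i j).

Definition mx_expect (p q : nat) (M : d.-tuple R -> 'M[R]_(p, q)) :
  'M[R]_(p, q) := \matrix_(i, j) fine (expect (fun v => M v i j)).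

Definition poly_fun (p : mpoly.mpoly d R) (v : d.-tuple R) : R :=
  mpoly.meval (tnth v) p.

Definition square_integrable (g : d.-tuple R -> R) : Prop :=
  measurable_fun D g /\ (expect (fun v => (g v ^+ 2)%R) < +oo)%E.

Definition orthogonal_basis (phi : nat -> mpoly.mpoly d R) : Prop :=
  [/\ forall i, square_integrable (poly_fun (phi i)),
      forall i, (0 < expect (fun v => (poly_fun (phi i) v ^+ 2)%R))%E,
      forall i j, i <> j ->
        expect (fun v => poly_fun (phi i) v * poly_fun (phi j) v) = 0%E
    & forall g, square_integrable g ->
        exists c : nat -> R,
          expect (fun v =>
            (g v - \sum_(i < N) c i * poly_fun (phi i) v) ^+ 2)
          @[N --> \oo] --> 0%E].

Context (phi : nat -> mpoly.mpoly d R).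

(** Block matrices with rows or columns indexed by [{0,1,2,...}] are given by
    their blocks. *)

(** The [i]-th block of [Phi (x) I_k]. *)
Definition Phi (k : nat) (v : d.-tuple R) (i : nat) : 'M[R]_k :=
  poly_fun (phi i) v *: 1%:M.

(** [(I (x) M) Z], for a block column [Z] and [I] the identity on
    [{0,1,2,...}]: the matrix [I (x) M] is block diagonal. *)
Definition kron_id_mul (p q r : nat) (M : 'M[R]_(p, q))
  (Z : nat -> 'M[R]_(q, r)) : nat -> 'M[R]_(p, r) := fun i => M *m Z i.

(** [(I (x) M^T) Z]^T = [Z^T (I (x) M)], for a block column [Z]. *)
Definition mul_kron_id (p q r : nat) (Z : nat -> 'M[R]_(p, r))
  (M : 'M[R]_(p, q)) : nat -> 'M[R]_(r, q) := fun j => (Z j)^T *m M.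

(** The first [N] terms of [Phi_k^T y]. *)
Definition PhiT_partial (k : nat) (y : d.-tuple R -> nat -> 'cV[R]_k) (N : nat)
  (v : d.-tuple R) : 'cV[R]_k := \sum_(i < N) (Phi k v i)^T *m y v i.

(** [xi = Phi_k^T z] is the second-order process with coefficient vector [z];
    the series converges in mean square. *)
Definition second_order_process (k : nat) (z : nat -> 'cV[R]_k)
  (xi : d.-tuple R -> 'cV[R]_k) : Prop :=
  forall a : 'I_k,
    square_integrable (fun v => xi v a 0) /\
    expect (fun v => (xi v a 0 - PhiT_partial (fun=> z) N v a 0) ^+ 2)
      @[N --> \oo] --> 0%E.

(** [eta = Phi_k^T y] for a coefficient vector [y] that depends on [Delta]; the
    series converges in probability.  When [xi = Phi_q^T z] in mean square, the
    series [Phi_p^T (I (x) M(Delta)) z] converges in probability, but, [M] being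
    unbounded, in general not in mean square. *)
Definition random_series (k : nat) (y : d.-tuple R -> nat -> 'cV[R]_k)
  (eta : d.-tuple R -> 'cV[R]_k) : Prop :=
  mx_measurable eta /\
  forall (a : 'I_k) (e : R), 0 < e ->
    P [set w | e <= `|eta (Delta w) a 0
                      - PhiT_partial y N (Delta w) a 0|]
      @[N --> \oo] --> 0%E.

End RandomVector.

Definition sym (R : realType) (n : nat) (X : 'M[R]_n) : 'M[R]_n := X + X^T.

Definition pos_def (R : realType) (n : nat) (M : 'M[R]_n) : Prop :=
  M^T = M /\ forall v : 'cV[R]_n, v != 0 -> 0 < (v^T *m M *m v) 0 0.

Definition pos_semidef (R : realType) (n : nat) (M : 'M[R]_n) : Prop :=
  M^T = M /\ forall v : 'cV[R]_n, 0 <= (v^T *m M *m v) 0 0.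

Section Synthesis.
Context (R : realType) (dO : measure_display) (Omega : measurableType dO).
Context (P : probability Omega R) (d : nat).
Context (Delta : {mfun Omega >-> d.-tuple R}) (D : set (d.-tuple R)).
Context (phi : nat -> mpoly.mpoly d R).
Context (n m : nat).
Context (A : d.-tuple R -> 'M[R]_n) (B : d.-tuple R -> 'M[R]_(n, m)).
Context (Q : 'M[R]_n) (Rw : 'M[R]_m).

Section Constraint.
Context (Y : d.-tuple R -> 'M[R]_n) (W : d.-tuple R -> 'M[R]_(m, n)).

(** Block [(i, j)] of
    [YY Phi_n A^T Phi_n^T + WW^T Phi_m B^T Phi_n^T],
    with [YY = I (x) Y] and [WW = I (x) W]. *)
Definition cross_block (i j : nat) (v : d.-tuple R) : 'M[R]_n :=
  kron_id_mul (Y v) (Phi phi n v) i *m (A v)^T *m (Phi phi n v j)^T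
  + kron_id_mul (W v)^T (Phi phi m v) i *m (B v)^T *m (Phi phi n v j)^T.

(** Block [(i, j)] of the matrix under the first expectation; block [(i, j)] of
    [X^T] is the transpose of block [(j, i)] of [X]. *)
Definition state_block (i j : nat) (v : d.-tuple R) : 'M[R]_n :=
  cross_block i j v + (cross_block j i v)^T
  + kron_id_mul (Y v) (Phi phi n v) i *m Q *m mul_kron_id (Phi phi n v) (Y v) j.

(** Block [(i, j)] of the matrix under the second expectation. *)
Definition control_block (i j : nat) (v : d.-tuple R) : 'M[R]_n :=
  kron_id_mul (W v)^T (Phi phi m v) i *m Rw
    *m mul_kron_id (Phi phi m v) (W v) j.

(** With [xi = Phi_n^T z], [eta = Phi_n^T YY z] and [zeta = Phi_m^T WW z], the
    values at [z] of the quadratic forms of the two matrices above. *)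
Definition state_form (xi eta : d.-tuple R -> 'cV[R]_n)
  (zeta : d.-tuple R -> 'cV[R]_m) (v : d.-tuple R) : R :=
  (sym ((eta v)^T *m (A v)^T *m xi v + (zeta v)^T *m (B v)^T *m xi v)
   + (eta v)^T *m Q *m eta v) 0 0.

Definition control_form (zeta : d.-tuple R -> 'cV[R]_m) (v : d.-tuple R) : R :=
  ((zeta v)^T *m Rw *m zeta v) 0 0.

(** The two expected matrices exist, and their sum is negative semidefinite:
    its quadratic form is nonpositive at every coefficient vector [z] of a
    second-order process at which it is finite (in particular at every finitely
    supported [z]). *)
Definition matrix_inequality : Prop :=
  (forall i j, mx_has_expect P Delta (state_block i j) /\
               mx_has_expect P Delta (control_block i j)) /\
  forall (z : nat -> 'cV[R]_n) (xi eta : d.-tuple R -> 'cV[R]_n)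
         (zeta : d.-tuple R -> 'cV[R]_m),
    second_order_process P Delta D phi z xi ->
    random_series P Delta D phi (fun v => kron_id_mul (Y v) z) eta ->
    random_series P Delta D phi (fun v => kron_id_mul (W v) z) zeta ->
    has_expect P Delta (state_form xi eta zeta) ->
    has_expect P Delta (control_form zeta) ->
    (expect P Delta (state_form xi eta zeta)
     + expect P Delta (control_form zeta) <= 0)%E.

Definition feasible : Prop :=
  [/\ mx_measurable D Y,
      mx_measurable D W,
      forall v, D v -> pos_def (Y v),
      mx_has_expect P Delta Y
    & matrix_inequality].

End Constraint.

Definition solves_program (Y : d.-tuple R -> 'M[R]_n)
  (W : d.-tuple R -> 'M[R]_(m, n)) : Prop :=
  feasible Y W /\
  forall Y' W', feasible Y' W' ->
    \tr (mx_expect P Delta Y') <= \tr (mx_expect P Delta Y).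

Context (x0 : 'cV[R]_n).

(** [x t v] is the state at time [t] for the parameter value [v]; its values at
    [t < 0] are irrelevant. *)
Definition closed_loop (K : d.-tuple R -> 'M[R]_(m, n))
  (x : R -> d.-tuple R -> 'cV[R]_n) : Prop :=
  forall v, D v ->
    [/\ x 0 v = x0,
        {within `[0, +oo[, continuous (fun t => x t v)}
      & forall t : R, 0 < t ->
          is_derive t 1 (fun s => x s v)
            (A v *m x t v + B v *m (K v *m x t v))].

(** Over the infinite horizon the cost is minimized, as usual, over the controls
    that drive the state to the origin.  Since [Q] is only semidefinite this is
    a genuine convention: for [n = m = 1], [A = B = Rw = 1], [Q = 0] the control
    [u = 0] has zero cost but an unbounded state.  When [Q] is positive definite,
    every state feedback of finite cost satisfies it. *)
Definition admissible (K : d.-tuple R -> 'M[R]_(m, n))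
  (x : R -> d.-tuple R -> 'cV[R]_n) : Prop :=
  [/\ mx_measurable D K,
      closed_loop K x
    & {ae P, forall w, x t (Delta w) @[t --> +oo] --> (0 : 'cV[R]_n)}].

Definition cost (K : d.-tuple R -> 'M[R]_(m, n))
  (x : R -> d.-tuple R -> 'cV[R]_n) : \bar R :=
  (\int[P]_w \int[lebesgue_measure]_(t in `[0%R, +oo[)
     (let xt := x t (Delta w) in
      let ut := K (Delta w) *m xt in
      (xt^T *m Q *m xt + ut^T *m Rw *m ut) ord0 ord0)%:E)%E.

(** The closed-loop trajectory [x] is determined by [K] for [t >= 0]. *)
Definition minimizes_cost (K : d.-tuple R -> 'M[R]_(m, n)) : Prop :=
  exists x, admissible K x /\
    forall K' x', admissible K' x' -> (cost K x <= cost K' x')%E.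

End Synthesis.

(* Main.v *)
Require Import Defs.
From HB Require Import structures.
From mathcomp Require Import all_boot all_order all_algebra.
From mathcomp Require Import all_classical all_reals all_analysis.
From mathcomp Require Import measurable_realfun ring lra.
From mathcomp Require mpoly.

(** With [P = Y^-1] and [K = W Y^-1], the constraint holds exactly when, almost
    surely, [x^T P x] decreases along the closed loop at least as fast as the
    running cost accumulates; in one direction one tests it with the processes
    [u 1_E], where [E] is a bounded event and [u] a rational vector, in the other
    the random series of [Y xi] and [W xi] have unique limits.

    One measurable policy-improvement step then gives everything.  Move [K] down
    the gradient [G = B^T P + R K] of the Hamiltonian, let [T <= P] be the value
    of the new gain, and replace [P] by the mean of [P] and [T].  The new pair is
    feasible once truncated to an event where it is bounded, and its trace is
    larger unless [T = P].  Maximality of [tr E[Y]] therefore forces [T = P]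
    almost surely, which means three things: [G = 0], the Lyapunov inequality is
    an equality, and the iterates that approach [T] from below exhaust [P], which
    makes the closed loop stable.  Hence the cost of [K] is [E[x0^T P x0]],
    while [G = 0] makes the Hamiltonian nonnegative for every control, so that any
    admissible control costs at least as much.

    The value [T] is built without matrix exponentials: the Cayley transform
    turns the Lyapunov equation into a Stein equation, whose fixed-point iteration
    is rational, hence measurable, in the parameter. *)

Set Implicit Arguments.
Unset Strict Implicit.
Unset Printing Implicit Defensive.

Import Order.TTheory GRing.Theory Num.Theory.
Import numFieldNormedType.Exports.

Local Open Scope classical_set_scope.
Local Open Scope ring_scope.

(** * Bilinear forms and definite matrices *)

Section BilinearForm.
Context {R : realFieldType}.
Implicit Types (n p : nat).

Definition bil n p (M : 'M[R]_(n, p)) (u : 'cV[R]_n) (v : 'cV[R]_p) : R :=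
  (u^T *m M *m v) 0 0.

(** The entrywise sum of absolute values is a crude stand-in for the operator norm: it bounds
    quadratic forms by [bil_abs_le] and is visibly measurable in the entries. *)
Definition abs_sum n p (M : 'M[R]_(n, p)) : R := \sum_i \sum_j `|M i j|.

Lemma bilE n p (M : 'M[R]_(n, p)) u v :
  bil M u v = \sum_i \sum_j M i j * (u i 0 * v j 0).
Proof.
rewrite /bil mxE exchange_big /=; apply: eq_bigr => j _.
rewrite mxE big_distrl /=; apply: eq_bigr => i _.
by rewrite !mxE; ring.
Qed.

Lemma bilDl n p (M : 'M[R]_(n, p)) u u' v :
  bil M (u + u') v = bil M u v + bil M u' v.
Proof. by rewrite /bil linearD !mulmxDl mxE. Qed.

Lemma bilDr n p (M : 'M[R]_(n, p)) u v v' :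
  bil M u (v + v') = bil M u v + bil M u v'.
Proof. by rewrite /bil mulmxDr mxE. Qed.

Lemma bilZl n p (M : 'M[R]_(n, p)) a u v : bil M (a *: u) v = a * bil M u v.
Proof. by rewrite /bil linearZ /= -!scalemxAl mxE. Qed.

Lemma bilZr n p (M : 'M[R]_(n, p)) a u v : bil M u (a *: v) = a * bil M u v.
Proof. by rewrite /bil -scalemxAr mxE. Qed.

Lemma bilNl n p (M : 'M[R]_(n, p)) u v : bil M (- u) v = - bil M u v.
Proof. by rewrite -scaleN1r bilZl mulN1r. Qed.

Lemma bilNr n p (M : 'M[R]_(n, p)) u v : bil M u (- v) = - bil M u v.
Proof. by rewrite -scaleN1r bilZr mulN1r. Qed.

Lemma bil0l n p (M : 'M[R]_(n, p)) v : bil M 0 v = 0.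
Proof. by rewrite -(scale0r 0) bilZl mul0r. Qed.

Lemma bil0r n p (M : 'M[R]_(n, p)) u : bil M u 0 = 0.
Proof. by rewrite -(scale0r 0) bilZr mul0r. Qed.

Lemma bil0m n p u v : bil (0 : 'M[R]_(n, p)) u v = 0.
Proof. by rewrite /bil mulmx0 mul0mx mxE. Qed.

Lemma bilDm n p (M N : 'M[R]_(n, p)) u v :
  bil (M + N) u v = bil M u v + bil N u v.
Proof. by rewrite /bil mulmxDr mulmxDl mxE. Qed.

Lemma bilZm n p (M : 'M[R]_(n, p)) a u v : bil (a *: M) u v = a * bil M u v.
Proof. by rewrite /bil -scalemxAr -scalemxAl mxE. Qed.

Lemma bilNm n p (M : 'M[R]_(n, p)) u v : bil (- M) u v = - bil M u v.
Proof. by rewrite -scaleN1r bilZm mulN1r. Qed.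

Lemma bil_sumr n p (I : Type) (r : seq I) (F : I -> 'M[R]_(n, p)) u v :
  bil (\sum_(i <- r) F i) u v = \sum_(i <- r) bil (F i) u v.
Proof.
elim: r => [|i r ih]; first by rewrite !big_nil bil0m.
by rewrite !big_cons bilDm ih.
Qed.

Lemma bil_mull n p q (N : 'M[R]_(n, p)) (M : 'M[R]_(p, q)) u v :
  bil (N *m M) u v = bil M (N^T *m u) v.
Proof. by rewrite /bil trmx_mul trmxK !mulmxA. Qed.

Lemma bil_mulr n p q (M : 'M[R]_(n, p)) (N : 'M[R]_(p, q)) u v :
  bil (M *m N) u v = bil M u (N *m v).
Proof. by rewrite /bil !mulmxA. Qed.

Lemma bil_congr n p (U : 'M[R]_(n, p)) (M : 'M[R]_n) u v :
  bil (U^T *m M *m U) u v = bil M (U *m u) (U *m v).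
Proof. by rewrite bil_mulr bil_mull trmxK. Qed.

Lemma bil_tr n p (M : 'M[R]_(n, p)) u v : bil M^T u v = bil M v u.
Proof.
rewrite !bilE exchange_big /=; apply: eq_bigr => i _.
by apply: eq_bigr => j _; rewrite mxE [u _ _ * _]mulrC.
Qed.

Lemma bil_symC n (M : 'M[R]_n) u v : M^T = M -> bil M u v = bil M v u.
Proof. by move=> {1}<-; rewrite bil_tr. Qed.

Lemma bil1E n (u v : 'cV[R]_n) : bil 1%:M u v = \sum_i u i 0 * v i 0.
Proof. by rewrite /bil mulmx1 mxE; apply: eq_bigr => i _; rewrite mxE. Qed.

Lemma bil1_ge0 n (u : 'cV[R]_n) : 0 <= bil 1%:M u u.
Proof. by rewrite bil1E sumr_ge0 // => i _; rewrite -expr2 sqr_ge0. Qed.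

Lemma bil1_eq0 n (u : 'cV[R]_n) : bil 1%:M u u = 0 -> u = 0.
Proof.
rewrite bil1E => u0; apply/matrixP => i j; rewrite mxE ord1.
by apply/eqP; rewrite -sqrf_eq0 expr2 (psumr_eq0P _ u0) // => k _; rewrite -expr2 sqr_ge0.
Qed.

Lemma sqr_coord_le n (u : 'cV[R]_n) i : u i 0 ^+ 2 <= bil 1%:M u u.
Proof.
rewrite bil1E (bigD1 i) //= -expr2 lerDl sumr_ge0 // => j _.
by rewrite -expr2 sqr_ge0.
Qed.

Lemma bil_delta n p (M : 'M[R]_(n, p)) i j :
  bil M (delta_mx i 0) (delta_mx j 0) = M i j.
Proof. by rewrite /bil trmx_delta -rowE -colE !mxE. Qed.

Lemma abs_sum_ge0 n p (M : 'M[R]_(n, p)) : 0 <= abs_sum M.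
Proof. by rewrite sumr_ge0 // => i _; rewrite sumr_ge0. Qed.

Lemma bil_abs_le n (M : 'M[R]_n) u :
  `|bil M u u| <= abs_sum M * bil 1%:M u u.
Proof.
rewrite bilE mulr_suml (le_trans (ler_norm_sum _ _ _)) // ler_sum // => i _.
rewrite mulr_suml (le_trans (ler_norm_sum _ _ _)) // ler_sum // => j _.
rewrite normrM ler_wpM2l // ler_norml.
have := sqr_coord_le u i; have := sqr_coord_le u j.
have := sqr_ge0 (u i 0 + u j 0); have := sqr_ge0 (u i 0 - u j 0).
by move=> *; apply/andP; split; nra.
Qed.

(** Polarization. It transfers convergence of quadratic forms to convergence of entries. *)
Lemma sym_entry n (M : 'M[R]_n) i j : M^T = M ->
  M i j = 2^-1 * (bil M (delta_mx i 0 + delta_mx j 0)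
                       (delta_mx i 0 + delta_mx j 0)
    - bil M (delta_mx i 0) (delta_mx i 0) - bil M (delta_mx j 0) (delta_mx j 0)).
Proof.
move=> Ms; rewrite -(bil_delta M i j) !bilDl !bilDr.
by rewrite (bil_symC (delta_mx j 0) (delta_mx i 0) Ms); field.
Qed.

End BilinearForm.

Section PositiveDefinite.
Context {R : realType} (n : nat).
Implicit Types (M P Y : 'M[R]_n) (u v : 'cV[R]_n).

Lemma pos_def_gt0 P v : pos_def P -> v != 0 -> 0 < bil P v v.
Proof. by move=> [_]; apply. Qed.

Lemma pos_def_ge0 P v : pos_def P -> 0 <= bil P v v.
Proof.
move=> Pp; have [->|v0] := eqVneq v 0; first by rewrite bil0l.
exact/ltW/pos_def_gt0.
Qed.

Lemma pos_def_eq0 P v : pos_def P -> bil P v v <= 0 -> v = 0.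
Proof.
move=> Pp; have [->//|v0] := eqVneq v 0.
by rewrite leNgt pos_def_gt0.
Qed.

Lemma unitmx_ker0 M : (forall v, M *m v = 0 -> v = 0) -> M \in unitmx.
Proof.
move=> M0; rewrite -unitmx_tr -row_free_unit; apply: inj_row_free => v vM.
by apply: trmx_inj; rewrite trmx0; apply: M0; rewrite -(trmxK M) -trmx_mul vM trmx0.
Qed.

Lemma pos_def_unit P : pos_def P -> P \in unitmx.
Proof.
move=> Pp; apply: unitmx_ker0 => v Pv; apply: (pos_def_eq0 Pp).
by rewrite /bil -mulmxA Pv mulmx0 mxE.
Qed.

Lemma pos_def_inv P : pos_def P -> pos_def (invmx P).
Proof.
move=> Pp; have Pu := pos_def_unit Pp.
have Ps : (invmx P)^T = invmx P by rewrite trmx_inv (proj1 Pp).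
split=> // v v0; rewrite -/(bil _ _ _).
have -> : bil (invmx P) v v = bil P (invmx P *m v) (invmx P *m v).
  by rewrite -bil_congr Ps mulVmx // mul1mx.
apply: pos_def_gt0 => //; apply: contra_neq v0 => /(congr1 (mulmx P)).
by rewrite mulKVmx // mulmx0.
Qed.

(** The form at [bil P v v *: u - bil P u v *: v] equals [bil P v v] times the difference of the two
    sides. *)
Lemma pos_def_cauchy P u v : pos_def P ->
  bil P u v ^+ 2 <= bil P u u * bil P v v.
Proof.
move=> Pp; have [->|v0] := eqVneq v 0; first by rewrite !bil0r expr0n mulr0.
have vv := pos_def_gt0 Pp v0.
have := pos_def_ge0 (bil P v v *: u - bil P u v *: v) Pp.
rewrite !(bilDl, bilDr, bilNl, bilNr, bilZl, bilZr).
rewrite (bil_symC v u (proj1 Pp)) => h.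
by rewrite -subr_ge0 -(pmulr_rge0 _ vv); nra.
Qed.

(** Cauchy-Schwarz for [P] at [v] and [P^-1 v] gives [|v|^4 <= P(v,v) P^-1(v,v)]; then bound
    [P^-1(v,v)] by [abs_sum] and divide by [|v|^2]. *)
Lemma norm_le_pos_def P v : pos_def P ->
  bil 1%:M v v <= abs_sum (invmx P) * bil P v v.
Proof.
move=> Pp; have Pu := pos_def_unit Pp; have Yp := pos_def_inv Pp.
have [->|v0] := eqVneq v 0; first by rewrite !bil0r mulr0.
have vv : 0 < bil 1%:M v v.
  by rewrite lt_neqAle bil1_ge0 andbT eq_sym; apply: contra_neq v0 => /bil1_eq0.
have := pos_def_cauchy v (invmx P *m v) Pp.
have -> : bil P v (invmx P *m v) = bil 1%:M v v.
  by rewrite -bil_mulr mulmxV.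
have -> : bil P (invmx P *m v) (invmx P *m v) = bil (invmx P) v v.
  by rewrite -bil_congr (proj1 Yp) mulVmx // mul1mx.
have := bil_abs_le (invmx P) v; rewrite ler_norml => /andP[_ h1] h2.
have h3 := pos_def_ge0 v Pp.
rewrite -(ler_pM2l vv) -expr2 (le_trans h2) //.
by rewrite mulrCA mulrA mulrC [X in _ <= X]mulrC; nra.
Qed.

Lemma tr_ge0 M : (forall v, 0 <= bil M v v) -> 0 <= \tr M.
Proof. by move=> M0; rewrite sumr_ge0 // => i _; rewrite -bil_delta. Qed.

(* A vanishing diagonal forces a semidefinite matrix to vanish: test it at
   [e_i + e_j] and [e_i - e_j]. *)
Lemma tr_eq0 M : M^T = M -> (forall v, 0 <= bil M v v) -> \tr M = 0 -> M = 0.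
Proof.
move=> Ms M0 trM; have D0 i : M i i = 0.
  apply: (psumr_eq0P _ trM) => // k _; by rewrite -bil_delta.
apply/matrixP => i j; rewrite mxE -bil_delta.
have := M0 (delta_mx i 0 + delta_mx j 0); have := M0 (delta_mx i 0 - delta_mx j 0).
rewrite !(bilDl, bilDr, bilNl, bilNr) (bil_symC (delta_mx j 0) _ Ms) !bil_delta.
by rewrite !D0 => *; lra.
Qed.

Lemma tr_inv_lt P P' : pos_def P -> pos_def P' ->
  (forall v, bil P' v v <= bil P v v) -> P' != P ->
  \tr (invmx P) < \tr (invmx P').
Proof.
move=> Pp P'p le_P neP.
have Pu := pos_def_unit Pp; have P'u := pos_def_unit P'p.
have [[Ps _] [P's _]] := (Pp, P'p).
have [[Ys _] [Y's _]] := (pos_def_inv Pp, pos_def_inv P'p).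
set Y := invmx P in Ys *; set Y' := invmx P' in Y's *; pose X := P - P'.
have Xs : X^T = X by rewrite linearB /= Ps P's.
(* [Y' - Y = Y X Y' = Y X Y + (X Y)^T Y' (X Y)] *)
have e1 : Y' = Y + Y *m X *m Y'.
  by rewrite /X mulmxBr mulVmx // mulmxBl mul1mx -mulmxA mulmxV // mulmx1 addrC subrK.
have e2 : Y' = Y + Y' *m X *m Y.
  by apply: trmx_inj; rewrite linearD /= !trmx_mul Ys Y's Xs mulmxA -e1.
have e3 : Y' = Y + (Y^T *m X *m Y + (X *m Y)^T *m Y' *m (X *m Y)).
  by rewrite {1}e1 {1}e2 trmx_mul Ys Xs mulmxDr !mulmxA.
rewrite e3 !mxtraceD ltrDl.
have X0 v : 0 <= bil X v v by rewrite bilDm bilNm subr_ge0.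
have h1 v : 0 <= bil (Y^T *m X *m Y) v v by rewrite bil_congr.
have h2 v : 0 <= bil ((X *m Y)^T *m Y' *m (X *m Y)) v v.
  by rewrite bil_congr pos_def_ge0 //; exact: pos_def_inv.
(* Either the first summand has positive trace, or [Y X Y] is semidefinite of trace 0, hence zero,
   and [X = 0] contradicts [neP]. *)
have := tr_ge0 h1; rewrite le_eqVlt => /orP[|h]; last exact: ltr_pwDl (tr_ge0 h2).
rewrite eq_sym => /eqP /(tr_eq0 _ h1) YXY0; exfalso; move/negP: neP; apply.
have {}YXY0 : Y^T *m X *m Y = 0 by apply: YXY0; rewrite !trmx_mul trmxK Xs mulmxA.
rewrite -subr_eq0 -oppr_eq0 opprB -/X; apply/eqP.
have := congr1 (fun N => P *m N *m P) YXY0; rewrite Ys mulmx0 mul0mx.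
by rewrite !mulmxA mulmxV // mul1mx -mulmxA mulVmx // mulmx1.
Qed.

End PositiveDefinite.

(** * Lyapunov equations through the Cayley transform *)

Lemma cvgr_sum {R : realType} (T : Type) (H : set_system T) {FF : Filter H}
    (I : Type) (r : seq I) (f : I -> T -> R) (l : I -> R) :
  (forall i, f i x @[x --> H] --> l i) ->
  \sum_(i <- r) f i x @[x --> H] --> \sum_(i <- r) l i.
Proof.
move=> fl; elim: r => [|i r ih].
  by rewrite big_nil; under eq_cvg do rewrite big_nil; exact: cvg_cst.
by rewrite big_cons; under eq_cvg do rewrite big_cons; exact: cvgD.
Qed.

Section CayleyIteration.
Context {R : realType} (n : nat).
Implicit Types (F C M P : 'M[R]_n) (u v x y : 'cV[R]_n).

Definition resolvent F : 'M[R]_n := invmx (1%:M - F).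

Definition cayley F : 'M[R]_n := (1%:M + F) *m resolvent F.

(* With [M = 2 J^T C J + U^T M U], where [J] is the resolvent and [U] the Cayley
   transform of [F], the Stein equation is the Lyapunov equation
   [F^T M + M F + C = 0]; this is its fixed-point iteration, started at [0]. *)
Fixpoint stein_iter F C (k : nat) : 'M[R]_n :=
  if k is k'.+1 then
    2 *: ((resolvent F)^T *m C *m resolvent F)
    + (cayley F)^T *m stein_iter F C k' *m cayley F
  else 0.

Definition policy_value F C : 'M[R]_n :=
  \matrix_(i, j) limn (fun k => stein_iter F C k i j).

Lemma stein_iterS F C k v :
  bil (stein_iter F C k.+1) v v =
  2 * bil C (resolvent F *m v) (resolvent F *m v)
  + bil (stein_iter F C k) (cayley F *m v) (cayley F *m v).
Proof. by rewrite bilDm bilZm !bil_congr. Qed.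

Lemma stein_iter_sym F C k : C^T = C -> (stein_iter F C k)^T = stein_iter F C k.
Proof.
move=> Cs; elim: k => [|k ih] /=; first exact: trmx0.
by rewrite linearD linearZ /= !trmx_mul !trmxK Cs ih !mulmxA.
Qed.

Context (F P C : 'M[R]_n).
Hypothesis Pp : pos_def P.
Hypothesis Cp : pos_semidef C.
Hypothesis lyap : forall x, 2 * bil P x (F *m x) + bil C x x <= 0.

Let C0 x : 0 <= bil C x x. Proof. exact: (proj2 Cp). Qed.

(** A fixed vector [v = F v] would give [2 P(v,v) + C(v,v) <= 0], so the Lyapunov inequality keeps 1
    out of the spectrum of [F]. *)
Lemma resolvent_unit : 1%:M - F \in unitmx.
Proof.
apply: unitmx_ker0 => v; rewrite mulmxBl mul1mx => /eqP; rewrite subr_eq0 => /eqP vF.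
apply: (pos_def_eq0 Pp); have := lyap v; rewrite -vF => h; have := C0 v; lra.
Qed.

Lemma resolventE y : resolvent F *m (y - F *m y) = y.
Proof. by rewrite -{1}(mul1mx y) -mulmxBl mulKmx ?resolvent_unit. Qed.

Lemma cayleyE y : cayley F *m (y - F *m y) = y + F *m y.
Proof. by rewrite -mulmxA resolventE mulmxDl mul1mx. Qed.

Lemma resolvent_surj v : v = resolvent F *m v - F *m (resolvent F *m v).
Proof. by rewrite -[X in X - _]mul1mx -mulmxBl mulKVmx ?resolvent_unit. Qed.

(** The bridge between the two equations: at [v = y - F y], where [y] is the resolvent of [v], the
    change of [M] under the Cayley transform is twice the Lyapunov term [2 M(y, F y)]. *)
Lemma cayley_bil M y : M^T = M ->
  bil M (y + F *m y) (y + F *m y) =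
  bil M (y - F *m y) (y - F *m y) + 4 * bil M y (F *m y).
Proof.
move=> Ms; rewrite !(bilDl, bilDr, bilNl, bilNr) (bil_symC (F *m y) y Ms); ring.
Qed.

(** [P] is a supersolution of the Stein equation, so the monotone iteration started at 0 stays below
    it. *)
Lemma stein_super v : 2 * bil C (resolvent F *m v) (resolvent F *m v)
  + bil P (cayley F *m v) (cayley F *m v) <= bil P v v.
Proof.
rewrite (resolvent_surj v) resolventE cayleyE cayley_bil; last by case: Pp.
have := lyap (resolvent F *m v); lra.
Qed.

Lemma stein_iter_le k v : bil (stein_iter F C k) v v <= bil P v v.
Proof.
elim: k v => [|k ih] v; first by rewrite bil0m pos_def_ge0.
rewrite stein_iterS; apply: le_trans (stein_super v).
by rewrite lerD2l ih.
Qed.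

Lemma stein_iter_homo v :
  {homo (fun k => bil (stein_iter F C k) v v) : k l / (k <= l)%N >-> k <= l}.
Proof.
apply: homo_leq => [//||k]; first exact: le_trans.
elim: k v => [|k ih] v.
  by rewrite stein_iterS !bil0m addr0 mulr_ge0.
by rewrite stein_iterS [leRHS]stein_iterS lerD2l ih.
Qed.

(** The quadratic forms increase and are bounded by that of [P]; polarization then gives the
    entries. *)
Lemma stein_iter_cvg i j :
  (fun k => stein_iter F C k i j) @ \oo --> policy_value F C i j.
Proof.
rewrite mxE; have cq v : cvgn (fun k => bil (stein_iter F C k) v v).
  apply: nondecreasing_is_cvgn; first exact: stein_iter_homo.
  by exists (bil P v v) => _ [k _ <-]; exact: stein_iter_le.
have -> : (fun k => stein_iter F C k i j) = (fun k => 2^-1 *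
  (bil (stein_iter F C k) (delta_mx i 0 + delta_mx j 0) (delta_mx i 0 + delta_mx j 0)
    - bil (stein_iter F C k) (delta_mx i 0) (delta_mx i 0)
    - bil (stein_iter F C k) (delta_mx j 0) (delta_mx j 0))).
  by apply/funext => k; apply/sym_entry/stein_iter_sym; case: Cp.
by apply: is_cvgMr; apply: is_cvgB; [apply: is_cvgB|].
Qed.

Lemma bil_iter_cvg u v :
  (fun k => bil (stein_iter F C k) u v) @ \oo --> bil (policy_value F C) u v.
Proof.
have -> : (fun k => bil (stein_iter F C k) u v) = fun k => \sum_i \sum_j
    stein_iter F C k i j * (u i 0 * v j 0).
  by apply/funext => k; rewrite bilE.
rewrite bilE; apply: cvgr_sum => i; apply: cvgr_sum => j.
by apply: cvgMl; exact: stein_iter_cvg.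
Qed.

Arguments bil_iter_cvg : clear implicits.

Lemma policy_value_sym : (policy_value F C)^T = policy_value F C.
Proof.
apply/matrixP => i j; rewrite !mxE; congr (limn _); apply/funext => k.
by have /matrixP/(_ i j) := stein_iter_sym F k (proj1 Cp); rewrite mxE.
Qed.

Lemma policy_value_le v : bil (policy_value F C) v v <= bil P v v.
Proof.
have /cvg_lim <- := bil_iter_cvg v v => //.
apply: limr_le; first by apply/cvg_ex; eexists; exact: bil_iter_cvg.
apply: nearW => k; exact: stein_iter_le.
Qed.

Lemma stein_iter_ge0 k v : 0 <= bil (stein_iter F C k) v v.
Proof. by rewrite -[leLHS](bil0m v v); exact: (stein_iter_homo v (leq0n k)). Qed.

Lemma policy_value_ge0 v : 0 <= bil (policy_value F C) v v.
Proof.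
have /cvg_lim <- := bil_iter_cvg v v => //.
apply: limr_ge; first by apply/cvg_ex; eexists; exact: bil_iter_cvg.
apply: nearW => k; exact: stein_iter_ge0.
Qed.

Lemma policy_value_stein v : bil (policy_value F C) v v =
  2 * bil C (resolvent F *m v) (resolvent F *m v)
  + bil (policy_value F C) (cayley F *m v) (cayley F *m v).
Proof.
have h1 : (fun k => bil (stein_iter F C k.+1) v v) @ \oo -->
    bil (policy_value F C) v v.
  by have := bil_iter_cvg v v; rewrite -cvg_shiftS.
suff h2 : (fun k => bil (stein_iter F C k.+1) v v) @ \oo -->
    2 * bil C (resolvent F *m v) (resolvent F *m v)
    + bil (policy_value F C) (cayley F *m v) (cayley F *m v).
  exact: (cvg_unique _ h1 h2).
under eq_fun do rewrite stein_iterS.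
by apply: cvgD; [exact: cvg_cst | exact: bil_iter_cvg].
Qed.

(** The Stein equation read at [v = x - F x], through [cayley_bil]. *)
Lemma policy_value_lyap x :
  2 * bil (policy_value F C) x (F *m x) + bil C x x = 0.
Proof.
have := policy_value_stein (x - F *m x).
rewrite resolventE cayleyE cayley_bil ?policy_value_sym //; lra.
Qed.

Lemma pos_def_average : pos_def (2^-1 *: (P + policy_value F C)).
Proof.
split; first by rewrite linearZ linearD /= policy_value_sym; case: Pp => ->.
move=> v v0; rewrite -/(bil _ _ _) bilZm bilDm.
have := pos_def_gt0 Pp v0; have := policy_value_ge0 v; lra.
Qed.

Section Stable.
Hypothesis PE : policy_value F C = P.

Lemma stable_lyap x : 2 * bil P x (F *m x) + bil C x x = 0.
Proof. by rewrite -{1}PE policy_value_lyap. Qed.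

(* [L] is the sum of the [(U^j)^T P U^j] for [j < k], where [k] is such that
   [(U^k)^T P U^k <= P / 2]. *)
Lemma stable_lyapunov : exists L : 'M[R]_n, [/\ L^T = L,
  forall x, 0 <= bil L x x &
  forall x, 2 * bil L x (F *m x) <= - (4^-1 * bil P x x)].
Proof.
pose D k := P - stein_iter F C k.
have Ds k : (D k)^T = D k.
  by rewrite linearB /= stein_iter_sym; [case: Pp => -> | case: Cp].
have D0 k v : 0 <= bil (D k) v v by rewrite bilDm bilNm subr_ge0 stein_iter_le.
(* Since [P] itself solves the Stein equation, [C] cancels in the difference, and [D k] is the
   pullback of [P] by the [k]-th power of the Cayley transform. *)
have DS k v : bil (D k.+1) v v = bil (D k) (cayley F *m v) (cayley F *m v).
  rewrite !bilDm !bilNm stein_iterS -{1}PE policy_value_stein PE; ring.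
have [k Dk] : exists k, abs_sum (D k) * abs_sum (invmx P) <= 2^-1.
  have : (fun k => abs_sum (D k) * abs_sum (invmx P)) @ \oo --> 0 * abs_sum (invmx P).
    apply: cvgMl; have -> : 0 = \sum_(i < n) \sum_(j < n) (0 : R).
      by rewrite big1 // => i _; rewrite big1.
    apply: cvgr_sum => i; apply: cvgr_sum => j.
    rewrite -[X in _ --> X](@normr0 _ R); apply: cvg_norm.
    rewrite -[X in _ --> X](subrr (P i j)) -{2}PE.
    have -> : (fun k => D k i j) = fun k => P i j - stein_iter F C k i j.
      by apply/funext => k; rewrite !mxE.
    by apply: cvgB; [exact: cvg_cst|exact: stein_iter_cvg].
  rewrite mul0r => /cvgr0_norm_le /(_ 2^-1) h.
  have [|k _ /(_ k (leqnn k))] := h; first by rewrite invr_gt0.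
  by exists k; exact: le_trans (ler_norm _) _.
exists (\sum_(j < k) D j); split.
- by rewrite linear_sum; apply: eq_bigr => j _; exact: Ds.
- by move=> x; rewrite bil_sumr sumr_ge0.
move=> x; have Ls : (\sum_(j < k) D j)^T = \sum_(j < k) D j.
  by rewrite linear_sum; apply: eq_bigr => j _; exact: Ds.
have := cayley_bil x Ls; rewrite -cayleyE; set v := x - _.
(* Applying the Cayley transform shifts the index of each summand, so the sum telescopes, with
   [D 0 = P]. *)
have -> : bil (\sum_(j < k) D j) (cayley F *m v) (cayley F *m v) =
    bil (\sum_(j < k) D j) v v + (bil (D k) v v - bil P v v).
  rewrite !bil_sumr; under eq_bigr do rewrite -DS.
  have -> : bil P v v = bil (D 0%N) v v by rewrite /D subr0.
  clear Dk Ls; elim: k => [|k ih]; first by rewrite !big_ord0 add0r subrr.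
  by rewrite big_ord_recr ih [in RHS]big_ord_recr /=; ring.
have : bil (D k) v v <= 2^-1 * bil P v v.
  have := bil_abs_le (D k) v; rewrite ler_norml => /andP[_ /le_trans]; apply.
  apply: le_trans (ler_wpM2l (abs_sum_ge0 _) (norm_le_pos_def v Pp)) _.
  by rewrite mulrA ler_wpM2r // pos_def_ge0.
(* With this, [4 L(x, F x) = D_k(v,v) - P(v,v) <= - P(v,v) / 2 <= - P(x,x) / 2], which is where
   [4^-1] comes from. *)
have : bil P x x <= bil P v v.
  rewrite /v !(bilDl, bilDr, bilNl, bilNr) (bil_symC (F *m x) x (proj1 Pp)).
  have := lyap x; have := C0 x; have := pos_def_ge0 (F *m x) Pp; lra.
lra.
Qed.

End Stable.

End CayleyIteration.

(** * Policy improvement *)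

Section PolicyImprovement.
Context {R : realType} (n m : nat).
Context (A : 'M[R]_n) (B : 'M[R]_(n, m)) (Q : 'M[R]_n) (Rw : 'M[R]_m).
Hypothesis Qp : pos_semidef Q.
Hypothesis Rp : pos_semidef Rw.

Definition lmi_mx (Y : 'M[R]_n) (W : 'M[R]_(m, n)) : 'M[R]_n :=
  sym (Y *m A^T + W^T *m B^T) + Y *m Q *m Y + W^T *m Rw *m W.

(* The derivative of [x^T P x] along [x' = A x + B u], plus the running cost. *)
Definition hamiltonian (P : 'M[R]_n) (x : 'cV[R]_n) (u : 'cV[R]_m) : R :=
  2 * bil P x (A *m x + B *m u) + bil Q x x + bil Rw u u.

(** The substitution [x = Y v], for which [W v = K x], is a congruence that turns the linear matrix
    inequality into a dissipation inequality for [P = Y^-1]. *)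
Lemma lmi_mx_hamiltonian Y W v : pos_def Y ->
  bil (lmi_mx Y W) v v = hamiltonian (invmx Y) (Y *m v) (W *m v).
Proof.
move=> Yp; have Yu := pos_def_unit Yp; have [Ys _] := Yp.
have YPE z : bil (invmx Y) (Y *m v) z = bil 1%:M v z.
  by rewrite -{2}Ys -bil_mull mulmxV.
have QE : bil (Y *m Q *m Y) v v = bil Q (Y *m v) (Y *m v).
  by rewrite -bil_congr Ys.
rewrite /lmi_mx /sym 2!bilDm QE bil_congr /hamiltonian; congr (_ + _ + _).
rewrite YPE bilDm bil_tr -mulr2n bilDm bilDr !bil_mull !bil_tr trmxK.
by rewrite Ys -!bil_mulr !mul1mx mulr_natl.
Qed.

Section Improve.
Context (Y : 'M[R]_n) (W : 'M[R]_(m, n)).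

Definition gain : 'M[R]_(m, n) := W *m invmx Y.

(* [hamiltonian P x u] with [P = Y^-1], as a function of [u] around [u = K x],
   has gradient [2 G x]; [improved_gain] is a step down that gradient, short
   enough to pay off whatever [Rw] is. *)
Definition gain_gradient : 'M[R]_(m, n) := B^T *m invmx Y + Rw *m gain.

Definition improved_gain : 'M[R]_(m, n) :=
  gain - (1 + abs_sum Rw)^-1 *: gain_gradient.

Definition improved_drift : 'M[R]_n := A + B *m improved_gain.

Definition improved_weight : 'M[R]_n :=
  Q + improved_gain^T *m Rw *m improved_gain.

Definition improved_value : 'M[R]_n := policy_value improved_drift improved_weight.

(* Averaging with [Y^-1] keeps the matrix definite where [improved_value] is
   only semidefinite. *)
Definition improved_Y : 'M[R]_n := invmx (2^-1 *: (invmx Y + improved_value)).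

Definition improved_W : 'M[R]_(m, n) := improved_gain *m improved_Y.

Hypothesis Yp : pos_def Y.
Hypothesis lmi : forall v, bil (lmi_mx Y W) v v <= 0.

Let Pp : pos_def (invmx Y) := pos_def_inv Yp.

Lemma hamiltonian_gain_le0 x : hamiltonian (invmx Y) x (gain *m x) <= 0.
Proof.
have := lmi (invmx Y *m x).
by rewrite lmi_mx_hamiltonian // mulKVmx ?pos_def_unit // mulmxA.
Qed.

(** The Hamiltonian is quadratic in the control, so its second-order expansion around [gain *m x] is
    exact. *)
Lemma hamiltonianD x w : hamiltonian (invmx Y) x (gain *m x + w) =
  hamiltonian (invmx Y) x (gain *m x) + 2 * bil 1%:M (gain_gradient *m x) w
  + bil Rw w w.
Proof.
rewrite /hamiltonian mulmxDr !(bilDl, bilDr) (bil_symC w _ (proj1 Rp)).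
have -> : bil 1%:M (gain_gradient *m x) w =
    bil (invmx Y) x (B *m w) + bil Rw (gain *m x) w.
  rewrite mulmxDl bilDl -!mulmxA; congr (_ + _).
    by rewrite -bil_mull mulmx1 -[RHS]bil_mulr bil_mull (proj1 Pp).
  by rewrite -[in LHS](proj1 Rp) -bil_mull mulmx1.
by ring.
Qed.

(** A step [- c g] changes the Hamiltonian by [- 2 c |g|^2 + c^2 Rw(g,g)]; the choice of [c] ensures
    [c Rw(g,g) <= |g|^2], so at least [c |g|^2] is gained. *)
Lemma hamiltonian_improved_le x :
  hamiltonian (invmx Y) x (improved_gain *m x)
  + (1 + abs_sum Rw)^-1 * bil 1%:M (gain_gradient *m x) (gain_gradient *m x)
  <= hamiltonian (invmx Y) x (gain *m x).
Proof.
set c := _^-1; set g := gain_gradient *m x.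
have -> : improved_gain *m x = gain *m x + - (c *: g).
  by rewrite mulmxBl -scalemxAl.
rewrite hamiltonianD -/g !(bilNl, bilNr, bilZl, bilZr).
have Rc : c * bil Rw g g <= bil 1%:M g g.
  have := bil_abs_le Rw g; rewrite ler_norml => /andP[_ h].
  have s0 := abs_sum_ge0 Rw; have g0 := bil1_ge0 g.
  rewrite ler_pdivrMl; first by nra.
  by lra.
have c0 : 0 <= c by rewrite invr_ge0; have := abs_sum_ge0 Rw; lra.
nra.
Qed.

Lemma hamiltonian_drift (P : 'M[R]_n) x :
  hamiltonian P x (improved_gain *m x) =
  2 * bil P x (improved_drift *m x) + bil improved_weight x x.
Proof.
rewrite /hamiltonian /improved_drift /improved_weight bilDm bil_congr.
by rewrite (mulmxDl A) -(mulmxA B) addrA.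
Qed.

Lemma improved_weight_psd : pos_semidef improved_weight.
Proof.
split.
  by rewrite linearD /= !trmx_mul trmxK (proj1 Qp) (proj1 Rp) mulmxA.
move=> v; rewrite -/(bil _ _ _) bilDm bil_congr addr_ge0 //.
  exact: (proj2 Qp).
exact: (proj2 Rp).
Qed.

Lemma improved_lyap x :
  2 * bil (invmx Y) x (improved_drift *m x) + bil improved_weight x x <= 0.
Proof.
rewrite -hamiltonian_drift.
apply: le_trans (hamiltonian_gain_le0 x); apply: le_trans (hamiltonian_improved_le x).
rewrite lerDl mulr_ge0 ?bil1_ge0 // invr_ge0.
have := abs_sum_ge0 Rw; lra.
Qed.

Let P'p : pos_def (2^-1 *: (invmx Y + improved_value)) :=
  pos_def_average Pp improved_weight_psd improved_lyap.

Lemma improved_Y_pos_def : pos_def improved_Y.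
Proof. exact: pos_def_inv. Qed.

(** For the fixed improved gain the Hamiltonian is affine in [P]: it is nonpositive at [Y^-1] and
    zero at [improved_value], hence nonpositive at their mean. *)
Lemma improved_lmi v : bil (lmi_mx improved_Y improved_W) v v <= 0.
Proof.
rewrite (lmi_mx_hamiltonian _ _ improved_Y_pos_def) invmxK -mulmxA hamiltonian_drift.
set x := improved_Y *m v; rewrite bilZm bilDm.
have := policy_value_lyap Pp improved_weight_psd improved_lyap x.
have := improved_lyap x; rewrite -/improved_value; lra.
Qed.

(** The mean of [Y^-1] and a smaller [improved_value] lies below [Y^-1], and differs from it unless
    the two agree; [tr_inv_lt] would then make the trace strictly larger. *)
Lemma improved_tr : \tr improved_Y <= \tr Y -> improved_value = invmx Y.
Proof.
have [//|neT] := eqVneq improved_value (invmx Y).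
rewrite leNgt => /negP[]; rewrite -{1}(invmxK Y); apply: tr_inv_lt => //.
  move=> v; rewrite bilZm bilDm.
  have := policy_value_le Pp improved_weight_psd improved_lyap v.
  rewrite -/improved_value; lra.
apply: contra_neq neT => /(congr1 (fun M => 2 *: M - invmx Y)).
rewrite scalerA divff // scale1r addrC addKr => ->.
by rewrite scaler_nat mulr2n addrK.
Qed.

Section Optimal.
Hypothesis opt : improved_value = invmx Y.

(** At the fixed point the Hamiltonian of the improved gain vanishes, while that of [gain] is
    nonpositive, which leaves no room for the decrease [c |g|^2]. *)
Lemma optimal_gradient : gain_gradient = 0.
Proof.
have g0 (x : 'cV[R]_n) : gain_gradient *m x = 0.
  apply: bil1_eq0; apply/eqP; rewrite eq_le bil1_ge0 andbT.
  have := hamiltonian_improved_le x; rewrite hamiltonian_drift.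
  rewrite (stable_lyap Pp improved_weight_psd improved_lyap opt) add0r.
  move/le_trans/(_ (hamiltonian_gain_le0 x)); rewrite pmulr_rle0 // invr_gt0.
  have := abs_sum_ge0 Rw; lra.
by apply/matrixP => i j; rewrite -[LHS]bil_delta /bil -mulmxA g0 mulmx0 !mxE.
Qed.

Lemma optimal_improved_gain : improved_gain = gain.
Proof. by rewrite /improved_gain optimal_gradient scaler0 subr0. Qed.

Lemma optimal_hamiltonian0 x : hamiltonian (invmx Y) x (gain *m x) = 0.
Proof.
rewrite -optimal_improved_gain hamiltonian_drift.
exact: (stable_lyap Pp improved_weight_psd improved_lyap opt).
Qed.

(** In the expansion around [gain *m x] the value and the gradient vanish; only [Rw(w,w)]
    survives. *)
Lemma optimal_hamiltonian_ge0 x u : 0 <= hamiltonian (invmx Y) x u.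
Proof.
rewrite -(subrK (gain *m x) u) addrC hamiltonianD optimal_hamiltonian0.
rewrite optimal_gradient mul0mx bil0l mulr0 addr0 add0r.
exact: (proj2 Rp).
Qed.

Lemma optimal_lyapunov : exists L : 'M[R]_n, [/\ L^T = L,
  forall x, 0 <= bil L x x &
  forall x, 2 * bil L x (A *m x + B *m (gain *m x))
    <= - (4^-1 * bil (invmx Y) x x)].
Proof.
have [L [Ls L0 LF]] := stable_lyapunov Pp improved_weight_psd improved_lyap opt.
exists L; split=> // x; have := LF x.
by rewrite /improved_drift optimal_improved_gain mulmxDl mulmxA.
Qed.

End Optimal.
End Improve.
End PolicyImprovement.

(** * Measurability of matrix functions *)

Section MatrixMeasurability.
Context {R : realType} {d : nat} (D : set (d.-tuple R)).
Local Notation mxfun p q := (d.-tuple R -> 'M[R]_(p, q)).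

Lemma measurable_funV_neq0 (f : d.-tuple R -> R) : measurable D ->
  measurable_fun D f -> (forall v, D v -> f v != 0) ->
  measurable_fun D (fun v => (f v)^-1).
Proof.
move=> mD mf f0; apply: (@measurable_comp _ _ _ _ _ _ [set x : R | x != 0] (@GRing.inv R)).
- exact: open_measurable.
- by move=> _ [v Dv <-]; exact: f0.
- apply: open_continuous_measurable_fun => //; apply/in_setP => x /= x0.
  exact: inv_continuous.
- exact: mf.
Qed.

Lemma mx_measurable_cst p q (M : 'M[R]_(p, q)) : mx_measurable D (fun=> M).
Proof. by move=> i j; exact: measurable_cst. Qed.

Lemma mx_measurableD p q (M N : mxfun p q) :
  mx_measurable D M -> mx_measurable D N -> mx_measurable D (fun v => M v + N v).
Proof.
move=> mM mN i j; under eq_fun do rewrite mxE.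
exact: measurable_funD.
Qed.

Lemma mx_measurableZ p q a (M : mxfun p q) :
  mx_measurable D M -> mx_measurable D (fun v => a *: M v).
Proof.
move=> mM i j; under eq_fun do rewrite mxE.
by apply: measurable_funM => //; exact: measurable_cst.
Qed.

Lemma mx_measurableN p q (M : mxfun p q) :
  mx_measurable D M -> mx_measurable D (fun v => - M v).
Proof.
by move=> mM; under eq_fun do rewrite -scaleN1r; exact: mx_measurableZ.
Qed.

Lemma mx_measurableM p q r (M : mxfun p q) (N : mxfun q r) :
  mx_measurable D M -> mx_measurable D N -> mx_measurable D (fun v => M v *m N v).
Proof.
move=> mM mN i j; under eq_fun do rewrite mxE.
by apply: measurable_sum => k; exact: measurable_funM.
Qed.

Lemma mx_measurable_tr p q (M : mxfun p q) :
  mx_measurable D M -> mx_measurable D (fun v => (M v)^T).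
Proof. by move=> mM i j; under eq_fun do rewrite mxE; exact: mM. Qed.

Lemma measurable_det p (M : mxfun p p) :
  mx_measurable D M -> measurable_fun D (fun v => \det (M v)).
Proof.
move=> mM; rewrite /determinant; apply: measurable_sum => s; apply: measurable_funM.
  exact: measurable_cst.
by apply: measurable_prod => i _; exact: mM.
Qed.

Lemma measurable_tr p (M : mxfun p p) :
  mx_measurable D M -> measurable_fun D (fun v => \tr (M v)).
Proof. by move=> mM; apply: measurable_sum => i; exact: mM. Qed.

Lemma mx_measurable_inv p (M : mxfun p p) : measurable D ->
  mx_measurable D M -> (forall v, D v -> M v \in unitmx) ->
  mx_measurable D (fun v => invmx (M v)).
Proof.
move=> mD mM uM i j.
(* The adjugate formula makes the inverse a rational function of the entries. *)
apply: (@eq_measurable_fun _ _ _ _ _ (fun v => (\det (M v))^-1 * \adj (M v) i j)).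
  by move=> v; rewrite inE => Dv; rewrite /invmx uM // [RHS]mxE.
apply: measurable_funM.
  apply: measurable_funV_neq0 => //; first exact: measurable_det.
  by move=> v /uM; rewrite unitmxE unitfE.
under eq_fun do rewrite mxE; apply: measurable_funM; first exact: measurable_cst.
by apply: measurable_det => k l; under eq_fun do rewrite !mxE; exact: mM.
Qed.

Lemma measurable_bil p q (M : mxfun p q) (u : d.-tuple R -> 'cV[R]_p)
  (v : d.-tuple R -> 'cV[R]_q) : mx_measurable D M ->
  mx_measurable D u -> mx_measurable D v ->
  measurable_fun D (fun x => bil (M x) (u x) (v x)).
Proof.
move=> mM mu mv.
have : mx_measurable D (fun x => (u x)^T *m M x *m v x); last exact.
by apply: mx_measurableM => //; apply: mx_measurableM => //; exact: mx_measurable_tr.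
Qed.

Lemma mx_measurable_if p q (f : d.-tuple R -> bool) (M N : mxfun p q) : measurable D ->
  measurable_fun D f -> mx_measurable (D `&` [set v | f v]) M ->
  mx_measurable D N -> mx_measurable D (fun v => if f v then M v else N v).
Proof.
move=> mD mf mM mN i j.
have -> : (fun v => (if f v then M v else N v) i j) =
          (fun v => if f v then M v i j else N v i j).
  by apply/funext => v; case: ifP.
apply: (measurable_fun_if mD mf); first exact: (mM i j).
by apply: (measurable_funS mD) (mN i j).
Qed.

End MatrixMeasurability.

Lemma mx_measurableS {R : realType} {d p q : nat} (D E : set (d.-tuple R))
    (M : d.-tuple R -> 'M[R]_(p, q)) :
  measurable D -> E `<=` D -> mx_measurable D M -> mx_measurable E M.
Proof. by move=> mD ED mM i j; exact: measurable_funS (mM i j). Qed.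

(** * Convergence in probability and random series *)

Section ConvergenceInProbability.
Context {R : realType} {dO : measure_display} {Omega : measurableType dO}.
Context (P : probability Omega R).
Implicit Types (X Y : (Omega -> R)^nat) (g : Omega -> R).

Definition cvg_prob0 X : Prop := forall e : R, 0 < e ->
  P [set w | e <= `|X N w|] @[N --> \oo] --> 0%E.

Lemma measurable_ge_norm g e : measurable_fun setT g ->
  measurable [set w | e <= `|g w|].
Proof.
move=> mg; rewrite -[X in measurable X]setTI.
apply: (@measurable_fun_le _ _ _ setT (cst e) (Num.norm \o g)) => //.
exact: measurableT_comp.
Qed.

Lemma cvge0P (u : (\bar R)^nat) : (forall k, 0 <= u k)%E ->
  (forall e : R, 0 < e -> \forall k \near \oo, (u k <= e%:E)%E) <->
  u @ \oo --> 0%E.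
Proof.
move=> u0; split=> [h|/fine_cvgP[uf u0'] e e0].
  apply/fine_cvgP; split.
    near=> k; rewrite ge0_fin_numE //; apply: (@le_lt_trans _ _ 1%:E); last exact: ltry.
    by near: k; exact: h.
  apply/cvgr0Pnorm_le => e e0; near=> k => /=.
  rewrite ger0_norm ?fine_ge0 // -lee_fin fineK.
    by near: k; exact: h.
  rewrite ge0_fin_numE //; apply: (@le_lt_trans _ _ 1%:E); last exact: ltry.
  by near: k; exact: h.
move/cvgr0Pnorm_le : u0' => /(_ e e0) u0'.
near=> k; rewrite -(@fineK _ (u k)); last by near: k.
by rewrite lee_fin (le_trans (ler_norm _)) //; near: k.
Unshelve. all: by end_near. Qed.

Lemma cvg_prob0D X Y : (forall N, measurable_fun setT (X N)) ->
  (forall N, measurable_fun setT (Y N)) ->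
  cvg_prob0 X -> cvg_prob0 Y -> cvg_prob0 (fun N w => X N w + Y N w).
Proof.
move=> mX mY X0 Y0 e e0; have e2 : 0 < e / 2 by rewrite divr_gt0.
apply: (@squeeze_cvge _ _ _ _ (cst 0%E) _ (fun N =>
  P [set w | (e / 2 <= `|X N w|)%R] + P [set w | (e / 2 <= `|Y N w|)%R])%E);
  [|exact: cvg_cst|].
  2:{  by rewrite -[X in _ --> X]adde0; apply: cvgeD => //; [exact: X0|exact: Y0]. }
apply: nearW => N; rewrite measure_ge0 /=.
apply: le_trans (measureU2 _ _ _); try exact: measurable_ge_norm.
apply: le_measure; rewrite ?inE.
- by apply: measurable_ge_norm; exact: measurable_funD.
- by apply: measurableU; exact: measurable_ge_norm.
move=> w /= h; have := ler_normD (X N w) (Y N w).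
by case: (leP (e / 2) `|X N w|) => ?; [left|right]; lra.
Qed.

Lemma cvg_prob0_sum (I : Type) (r : seq I) (X : I -> (Omega -> R)^nat) :
  (forall i N, measurable_fun setT (X i N)) -> (forall i, cvg_prob0 (X i)) ->
  cvg_prob0 (fun N w => \sum_(i <- r) X i N w).
Proof.
move=> mX X0; elim: r => [|i r ih].
  move=> e e0; rewrite (_ : (fun _ => _) = cst 0%E); first exact: cvg_cst.
  apply/funext => N /=; rewrite (_ : [set _ | _] = set0) ?measure0 //.
  by apply/seteqP; split=> w //=; rewrite big_nil normr0 leNgt e0.
rewrite (_ : (fun _ _ => _) = fun N w => X i N w + \sum_(j <- r) X j N w); last first.
  by apply/funext => N; apply/funext => w; rewrite big_cons.
by apply: cvg_prob0D => // N; exact: measurable_sum.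
Qed.

(** A finite random variable is tight: the events [|g| >= k + 1] decrease to the empty set. *)
Lemma prob_tail g (e : R) : measurable_fun setT g -> 0 < e ->
  exists2 k : R, 0 < k & (P [set w | (k <= `|g w|)%R] <= e%:E)%E.
Proof.
move=> mg e0; pose E k := [set w | k.+1%:R <= `|g w|].
have mE k : measurable (E k) by exact: measurable_ge_norm.
have : P \o E @ \oo --> P (\bigcap_k E k).
  apply: nonincreasing_cvg_mu => //.
  - by rewrite (le_lt_trans (probability_le1 _ _)) // ltry.
  - exact: bigcapT_measurable.
  move=> k l kl; apply/subsetPset => w /=; apply: le_trans.
  by rewrite ler_nat.
rewrite (_ : \bigcap_k E k = set0) ?measure0; last first.
  apply/seteqP; split=> // w /(_ (Num.truncn `|g w|) I); rewrite /E /=.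
  by rewrite leNgt truncnS_gt.
move/cvge0P => /(_ (fun k => measure_ge0 _ _) e e0) [k _ /(_ k (leqnn k)) h].
by exists k.+1%:R.
Qed.

(** The event [|g X| >= e] is contained in the union of [|g| >= k] and [|X| >= e / k], with [k]
    taken from [prob_tail]. *)
Lemma cvg_prob0M g X : measurable_fun setT g ->
  (forall N, measurable_fun setT (X N)) ->
  cvg_prob0 X -> cvg_prob0 (fun N w => g w * X N w).
Proof.
move=> mg mX X0 e e0; apply/cvge0P => [N|e' e'0]; first exact: measure_ge0.
have [k k0 Pk] := prob_tail mg (divr_gt0 e'0 (ltr0n _ 2)).
have /cvge0P /(_ (e' / 2)) := X0 _ (divr_gt0 e0 k0).
move=> /(_ (fun N => measure_ge0 _ _) (divr_gt0 e'0 (ltr0n _ 2))) h.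
near=> N; have hN : (P [set w | (e / k <= `|X N w|)%R] <= (e' / 2)%:E)%E by near: N.
apply: (@le_trans _ _ ((e' / 2)%:E + (e' / 2)%:E)%E); last first.
  by rewrite -EFinD -splitr.
apply: le_trans (leeD Pk hN); apply: le_trans (measureU2 _ _ _);
  try exact: measurable_ge_norm.
apply: le_measure; rewrite ?inE.
- by apply: measurable_ge_norm; exact: measurable_funM.
- by apply: measurableU; exact: measurable_ge_norm.
move=> w /=; rewrite normrM => ew.
case: (leP k `|g w|) => [?|gk]; [by left|right].
rewrite ler_pdivrMr // (le_trans ew) // mulrC.
by rewrite ler_wpM2l // ltW.
Unshelve. all: by end_near. Qed.

Lemma cvg_prob0_L2 X : (forall N, measurable_fun setT (X N)) ->
  (fun N => 'E_P[fun w => (X N w ^+ 2)%R]%E) @ \oo --> 0%E -> cvg_prob0 X.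
Proof.
move=> mX X0 e e0; have e2 : 0 < e ^+ 2 by rewrite exprn_gt0.
apply: (@squeeze_cvge _ _ _ _ (cst 0%E) _ (fun N =>
  ((e ^+ 2)^-1)%:E * 'E_P[fun w => (X N w ^+ 2)%R])%E); [|exact: cvg_cst|].
  2:{  rewrite -[X in _ --> X](mule0 ((e ^+ 2)^-1)%:E).
  by apply: cvgeZl. }
apply: nearW => N; rewrite measure_ge0 /= lee_pdivlMl //.
pose Y : {RV P >-> R} := mfun_Sub (mem_set (mX N)).
apply: (@le_trans _ _ ('E_P[(@GRing.exp R ^~ 2%N \o Num.norm) \o Y])%E).
  apply: (@markov _ _ _ P Y (@GRing.exp R ^~ 2%N)) => //.
  - by move=> r _; exact: sqr_ge0.
  - by move=> x y; rewrite !nnegrE => x0 y0; rewrite ler_sqr.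
rewrite (_ : _ \o _ = fun w => X N w ^+ 2) //.
by apply/funext => w /=; rewrite real_normK // num_real.
Qed.

Lemma cvg_prob0_cst g : measurable_fun setT g -> cvg_prob0 (fun=> g) ->
  {ae P, forall w, g w = 0}.
Proof.
move=> mg g0; have E0 k : P.-negligible [set w | k.+1%:R^-1 <= `|g w|].
  exists [set w | k.+1%:R^-1 <= `|g w|]; split=> //.
    exact: measurable_ge_norm.
  have := g0 k.+1%:R^-1; rewrite invr_gt0 ltr0n => /(_ isT).
  by move/(cvg_lim (@ereal_hausdorff R)); rewrite lim_cst.
apply: negligibleS (negligible_bigcup E0) => w /= /eqP gw.
(* If [g w] is nonzero, [1 / (truncn (1 / |g w|) + 1) <= |g w|], so [w] lies in one of the null
   events. *)
exists (Num.truncn (`|g w|^-1)) => //=.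
rewrite invf_ple ?posrE ?normr_gt0 ?ltr0n //.
by apply/ltW/truncnS_gt.
Qed.

End ConvergenceInProbability.

(** * Second-order processes and their random series *)

Section SecondOrderProcesses.
Context {R : realType} {dO : measure_display} {Omega : measurableType dO}.
Context {P : probability Omega R} {d : nat}.
Context {Delta : {mfun Omega >-> d.-tuple R}} {D : set (d.-tuple R)}.
Context {phi : nat -> mpoly.mpoly d R}.
Hypothesis mD : measurable D.
Hypothesis DD : forall w, D (Delta w).
Hypothesis hphi : orthogonal_basis P Delta D phi.

Lemma measurable_comp_Delta (g : d.-tuple R -> R) :
  measurable_fun D g -> measurable_fun setT (g \o Delta).
Proof.
move=> mg; apply: (@measurable_comp _ _ _ _ _ _ D g) => //.
by move=> _ [w _ <-]; exact: DD.
Qed.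

Lemma mx_measurable_comp_Delta p q (M : d.-tuple R -> 'M[R]_(p, q)) i j :
  mx_measurable D M -> measurable_fun setT (fun w => M (Delta w) i j).
Proof. by move=> mM; apply: (measurable_comp_Delta (g := fun v => M v i j)). Qed.

Lemma PhiT_partialE k (y : d.-tuple R -> nat -> 'cV[R]_k) N v a :
  PhiT_partial phi y N v a 0 = \sum_(i < N) poly_fun (phi i) v * y v i a 0.
Proof.
rewrite summxE; apply: eq_bigr => i _.
by rewrite /Phi linearZ /= trmx1 -scalemxAl mul1mx mxE.
Qed.

Lemma PhiT_partial_kron p q (M : d.-tuple R -> 'M[R]_(p, q)) z N v :
  PhiT_partial phi (fun v => kron_id_mul (M v) z) N v
  = M v *m PhiT_partial phi (fun=> z) N v.
Proof.
rewrite /PhiT_partial mulmx_sumr; apply: eq_bigr => i _.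
by rewrite /Phi /kron_id_mul !linearZ /= !trmx1 -!scalemxAl !mul1mx -scalemxAr.
Qed.

Lemma measurable_poly_fun i : measurable_fun D (poly_fun (phi i)).
Proof. by case: hphi => /(_ i) []. Qed.

Lemma measurable_PhiT_partial k (z : nat -> 'cV[R]_k) N :
  mx_measurable D (PhiT_partial phi (fun=> z) N).
Proof.
move=> a b; rewrite ord1; under eq_fun do rewrite PhiT_partialE.
apply: measurable_sum => i; apply: measurable_funM; last exact: measurable_cst.
exact: measurable_poly_fun.
Qed.

(** [I (x) M] acts blockwise, so each partial sum is [M] times a partial sum of [xi]. Mean-square
    convergence gives convergence in probability, which survives multiplication by the unbounded
    entries of [M]. *)
Lemma random_series_mul p q (M : d.-tuple R -> 'M[R]_(p, q)) z xi :
  mx_measurable D M -> second_order_process P Delta D phi z xi ->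
  random_series P Delta D phi (fun v => kron_id_mul (M v) z)
    (fun v => M v *m xi v).
Proof.
move=> mM zxi; have mxi : mx_measurable D xi.
  by move=> a b; rewrite ord1; have [[]] := zxi a.
split; first exact: mx_measurableM.
move=> a; pose X b N w := M (Delta w) a b *
  (xi (Delta w) b 0 - PhiT_partial phi (fun=> z) N (Delta w) b 0).
have XE N w : (M (Delta w) *m xi (Delta w)) a 0
    - PhiT_partial phi (fun v => kron_id_mul (M v) z) N (Delta w) a 0
    = \sum_b X b N w.
  by rewrite PhiT_partial_kron !mxE -sumrB; apply: eq_bigr => b _; rewrite /X mulrBr.
suff : cvg_prob0 P (fun N w => \sum_b X b N w).
  move=> h e e0; rewrite (_ : (fun N => _) = fun N =>
    P [set w | (e <= `|\sum_b X b N w|)%R]); first exact: h.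
  apply/funext => N; congr (P _).
  by apply/funext => w; rewrite /= XE.
have mX b N : measurable_fun setT
    (fun w => xi (Delta w) b 0 - PhiT_partial phi (fun=> z) N (Delta w) b 0).
  apply: measurable_funB; apply: mx_measurable_comp_Delta; first exact: mxi.
  exact: measurable_PhiT_partial.
apply: cvg_prob0_sum => b.
  by move=> N; apply: measurable_funM => //; exact: mx_measurable_comp_Delta.
apply: cvg_prob0M => //; first exact: mx_measurable_comp_Delta.
by apply: cvg_prob0_L2 => //; have [] := zxi b.
Qed.

(** The difference of the two limits, as a constant sequence, is the sum of two errors that tend to
    0 in probability. *)
Lemma random_series_unique p q (M : d.-tuple R -> 'M[R]_(p, q)) z eta eta' :
  mx_measurable D M ->
  random_series P Delta D phi (fun v => kron_id_mul (M v) z) eta ->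
  random_series P Delta D phi (fun v => kron_id_mul (M v) z) eta' ->
  {ae P, forall w, eta (Delta w) = eta' (Delta w)}.
Proof.
move=> mM [meta eta0] [meta' eta'0].
have mS N : mx_measurable D (PhiT_partial phi (fun v => kron_id_mul (M v) z) N).
  rewrite (_ : PhiT_partial _ _ N = fun v => M v *m PhiT_partial phi (fun=> z) N v);
    last by apply/funext => v; rewrite PhiT_partial_kron.
  by apply: mx_measurableM => //; exact: measurable_PhiT_partial.
have ae0 a : {ae P, forall w, eta (Delta w) a 0 - eta' (Delta w) a 0 = 0}.
  apply: cvg_prob0_cst.
    by apply: measurable_funB; apply: mx_measurable_comp_Delta.
  pose X N w := eta (Delta w) a 0
    - PhiT_partial phi (fun v => kron_id_mul (M v) z) N (Delta w) a 0.
  pose X' N w := -1 * (eta' (Delta w) a 0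
    - PhiT_partial phi (fun v => kron_id_mul (M v) z) N (Delta w) a 0).
  rewrite (_ : (fun=> _) = fun N w => X N w + X' N w); last first.
    by apply/funext => N; apply/funext => w; rewrite /X /X'; ring.
  have mX' N : measurable_fun setT (fun w => eta' (Delta w) a 0
    - PhiT_partial phi (fun v => kron_id_mul (M v) z) N (Delta w) a 0).
    by apply: measurable_funB; apply: mx_measurable_comp_Delta; [exact: meta'|exact: mS].
  apply: cvg_prob0D.
  - by move=> N; apply: measurable_funB; apply: mx_measurable_comp_Delta;
      [exact: meta|exact: mS].
  - by move=> N; apply: measurable_funM => //; exact: measurable_cst.
  - exact: eta0.
  apply: (@cvg_prob0M _ _ _ _ (cst (-1))) => //; exact: eta'0.
have : {ae P, forall w, forall a, eta (Delta w) a 0 - eta' (Delta w) a 0 = 0}.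
  exact: filter_forall.
apply: filterS => w h; apply/matrixP => a b; rewrite ord1; apply/eqP.
by rewrite -subr_eq0 h.
Qed.

Lemma second_order_exists k (xi : d.-tuple R -> 'cV[R]_k) :
  (forall a, square_integrable P Delta D (fun v => xi v a 0)) ->
  exists z, second_order_process P Delta D phi z xi.
Proof.
move=> sxi; have [_ _ _ basis] := hphi.
have /choice[c cP] : forall a, exists c : nat -> R,
    expect P Delta (fun v => (xi v a 0 - \sum_(i < N) c i * poly_fun (phi i) v) ^+ 2)
    @[N --> \oo] --> 0%E by move=> a; exact: basis.
exists (fun i => \col_a c a i) => a; split=> //.
rewrite (_ : (fun N => _) = fun N => expect P Delta
  (fun v => (xi v a 0 - \sum_(i < N) c a i * poly_fun (phi i) v) ^+ 2)); first exact: cP.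
apply/funext => N; congr expect; apply/funext => v.
rewrite PhiT_partialE; congr ((_ - _) ^+ 2); apply: eq_bigr => i _.
by rewrite mxE mulrC.
Qed.

End SecondOrderProcesses.

(** * The linear matrix inequality, almost surely *)

Section RationalVectors.
Context {R : realType} (n : nat).

(** A countable dense family of test vectors, so that [almost surely for all u] follows from
    [for all u, almost surely]; codes of no vector give 0. *)
Definition rat_vec (k : nat) : 'cV[R]_n :=
  if unpickle k is Some u then map_mx ratr (u : 'cV[rat]_n) else 0.

Lemma rat_cvg (x : R) : exists q : nat -> rat, (fun k => ratr (q k) : R) @ \oo --> x.
Proof.
have /choice[q qP] : forall k : nat, exists q : rat,
    (ratr q : R) \in `]x, x + k.+1%:R^-1[.
  by move=> k; apply: rat_in_itvoo; rewrite ltrDl invr_gt0 ltr0n.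
exists q; apply: (@squeeze_cvgr _ _ _ _ (cst x) (fun k => x + k.+1%:R^-1)).
- by apply: nearW => k; have := qP k; rewrite in_itv /= => /andP[/ltW -> /ltW ->].
- exact: cvg_cst.
rewrite -[X in _ --> X]addr0; apply: cvgD; first exact: cvg_cst.
exact: cvg_harmonic.
Qed.

Lemma rat_vec_dense (M : 'M[R]_n) :
  (forall k, bil M (rat_vec k) (rat_vec k) <= 0) -> forall u, bil M u u <= 0.
Proof.
move=> M0 u; have /choice[q qP] : forall i, exists q : nat -> rat,
    (fun k => ratr (q k) : R) @ \oo --> u i 0 by move=> i; exact: rat_cvg.
pose w k : 'cV[R]_n := map_mx ratr (\col_i q i k).
have wM k : bil M (w k) (w k) <= 0.
  by have := M0 (pickle (\col_i q i k)); rewrite /rat_vec pickleK.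
have h : (fun k => bil M (w k) (w k)) @ \oo --> bil M u u.
  rewrite bilE; under eq_fun do rewrite bilE.
  apply: cvgr_sum => i; apply: cvgr_sum => j; apply: cvgMr.
  by apply: cvgM; under eq_fun do rewrite !mxE; exact: qP.
have /cvg_lim <- := h => //; apply: limr_le; first by apply/cvg_ex; eexists; exact: h.
exact: nearW.
Qed.

End RationalVectors.

Lemma ge0_expectation_le0 {R : realType} {dO : measure_display}
    {Omega : measurableType dO} (P : probability Omega R) (g : Omega -> R) :
  measurable_fun setT g -> (forall w, 0 <= g w) ->
  (\int[P]_w (g w)%:E <= 0)%E -> {ae P, forall w, g w = 0}.
Proof.
move=> mg g0 ig; have : (\int[P]_w `|(g w)%:E| = 0)%E.
  apply/eqP; rewrite eq_le integral_ge0 ?andbT //.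
  by under eq_integral do rewrite gee0_abs ?lee_fin //.
move/ae_eq_integral_abs => h.
have {}h : ae_eq P setT (EFin \o g) (cst 0%E) by apply: h => //; exact/measurable_EFinP.
by apply: filterS h => w /(_ I) [].
Qed.

Section Blocks.
Context {R : realType} {d : nat} (phi : nat -> mpoly.mpoly d R) {n m : nat}.
Context (A : d.-tuple R -> 'M[R]_n) (B : d.-tuple R -> 'M[R]_(n, m)).
Context (Q : 'M[R]_n) (Rw : 'M[R]_m).
Context (Y : d.-tuple R -> 'M[R]_n) (W : d.-tuple R -> 'M[R]_(m, n)).

(** The common factor of all blocks: block [(i, j)] is [phi_i phi_j] times this matrix. The same
    holds for [control_mx] and the second expectation. *)
Definition state_mx v : 'M[R]_n :=
  sym (Y v *m (A v)^T + (W v)^T *m (B v)^T) + Y v *m Q *m Y v.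

Definition control_mx v : 'M[R]_n := (W v)^T *m Rw *m W v.

Definition lmi v : 'M[R]_n := lmi_mx (A v) (B v) Q Rw (Y v) (W v).

Lemma lmiE v : lmi v = state_mx v + control_mx v.
Proof. by []. Qed.

Lemma kron_PhiE p q (M : 'M[R]_(p, q)) v i :
  kron_id_mul M (Phi phi q v) i = poly_fun (phi i) v *: M.
Proof. by rewrite /kron_id_mul /Phi -scalemxAr mulmx1. Qed.

Lemma Phi_kronE p q (M : 'M[R]_(p, q)) v i :
  mul_kron_id (Phi phi p v) M i = poly_fun (phi i) v *: M.
Proof. by rewrite /mul_kron_id /Phi linearZ /= trmx1 -scalemxAl mul1mx. Qed.

Lemma cross_blockE i j v : cross_block phi A B Y W i j v =
  (poly_fun (phi i) v * poly_fun (phi j) v) *: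
    (Y v *m (A v)^T + (W v)^T *m (B v)^T).
Proof.
rewrite /cross_block !kron_PhiE /Phi linearZ /= trmx1 -!scalemxAr !mulmx1.
by rewrite -!scalemxAl !scalerA -scalerDr mulrC.
Qed.

Lemma state_blockE i j v : state_block phi A B Q Y W i j v =
  (poly_fun (phi i) v * poly_fun (phi j) v) *: state_mx v.
Proof.
rewrite /state_block !cross_blockE kron_PhiE Phi_kronE /state_mx /sym.
rewrite [X in _ + X + _]linearZ /= (mulrC (poly_fun (phi j) v)) -scalemxAr.
by rewrite -!scalemxAl scalerA mulrC -!scalerDr.
Qed.

Lemma control_blockE i j v : control_block phi Rw W i j v =
  (poly_fun (phi i) v * poly_fun (phi j) v) *: control_mx v.
Proof.
rewrite /control_block kron_PhiE Phi_kronE /control_mx -scalemxAr.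
by rewrite -!scalemxAl scalerA mulrC.
Qed.

Lemma state_formE xi eta zeta v : (Y v)^T = Y v ->
  eta v = Y v *m xi v -> zeta v = W v *m xi v ->
  state_form A B Q xi eta zeta v = bil (state_mx v) (xi v) (xi v).
Proof.
move=> Ys eE zE; rewrite /state_form eE zE !trmx_mul Ys /state_mx /bil.
set S := _ + (W v)^T *m _.
have -> : (xi v)^T *m Y v *m (A v)^T *m xi v
    + (xi v)^T *m (W v)^T *m (B v)^T *m xi v = (xi v)^T *m S *m xi v.
  by rewrite /S mulmxDr mulmxDl !mulmxA.
move: S => S; have -> : sym ((xi v)^T *m S *m xi v) = (xi v)^T *m sym S *m xi v.
  by rewrite /sym !trmx_mul trmxK mulmxDr mulmxDl !mulmxA.
by rewrite [in RHS]mulmxDr mulmxDl !mulmxA.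
Qed.

Lemma control_formE xi zeta v : zeta v = W v *m xi v ->
  control_form Rw zeta v = bil (control_mx v) (xi v) (xi v).
Proof. by move=> zE; rewrite /control_form zE trmx_mul /bil !mulmxA. Qed.

End Blocks.

Lemma bounded_integrable {R : realType} {dO : measure_display}
    {Omega : measurableType dO} (P : probability Omega R) (g : Omega -> R) (k : R) :
  measurable_fun setT g -> (forall w, `|g w| <= k) ->
  P.-integrable setT (EFin \o g).
Proof.
move=> mg gk; apply: (@le_integrable _ _ _ _ _ _ _ (cst k%:E)) => //.
- exact/measurable_EFinP.
- by move=> w _ /=; rewrite lee_fin (le_trans (gk w)) // ler_norm.
- exact: finite_measure_integrable_cst.
Qed.

Section LmiMeasurability.
Context {R : realType} {d : nat} (E : set (d.-tuple R)) {n m : nat}.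
Context (A : d.-tuple R -> 'M[R]_n) (B : d.-tuple R -> 'M[R]_(n, m)).
Context (Q : 'M[R]_n) (Rw : 'M[R]_m).
Context (Y : d.-tuple R -> 'M[R]_n) (W : d.-tuple R -> 'M[R]_(m, n)).
Hypothesis mA : mx_measurable E A.
Hypothesis mB : mx_measurable E B.
Hypothesis mY : mx_measurable E Y.
Hypothesis mW : mx_measurable E W.

Lemma measurable_state_mx : mx_measurable E (state_mx A B Q Y W).
Proof.
have mS : mx_measurable E (fun v => Y v *m (A v)^T + (W v)^T *m (B v)^T).
  by apply: mx_measurableD; apply: mx_measurableM => //; do ?exact: mx_measurable_tr.
apply: mx_measurableD; first by apply: mx_measurableD => //; exact: mx_measurable_tr.
apply: mx_measurableM => //; apply: mx_measurableM => //; exact: mx_measurable_cst.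
Qed.

Lemma measurable_control_mx : mx_measurable E (control_mx Rw W).
Proof.
apply: mx_measurableM => //; apply: mx_measurableM; first exact: mx_measurable_tr.
exact: mx_measurable_cst.
Qed.

Lemma measurable_lmi : mx_measurable E (lmi A B Q Rw Y W).
Proof.
exact: mx_measurableD measurable_state_mx measurable_control_mx.
Qed.

(** Semidefiniteness need only be tested at the rational vectors, which makes the set a countable
    intersection. *)
Lemma measurable_lmi_nsd : measurable E ->
  measurable (E `&` [set v | forall u, bil (lmi A B Q Rw Y W v) u u <= 0]).
Proof.
move=> mE; rewrite (_ : _ `&` _ = \bigcap_k (E `&`
    [set v | bil (lmi A B Q Rw Y W v) (rat_vec n k) (rat_vec n k) <= 0])).
  apply: bigcapT_measurable => k; apply: measurable_fun_le => //.
    by apply: measurable_bil; [exact: measurable_lmi|exact: mx_measurable_cst..].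
apply/seteqP; split=> [v [Ev h] k _|v h]; first by split=> //; exact: h.
split; first by have [] := h 0%N I.
by apply: rat_vec_dense => k; have [] := h k I.
Qed.

End LmiMeasurability.

Section Optimality.
Context {R : realType} {dO : measure_display} {Omega : measurableType dO}.
Context {P : probability Omega R} {d : nat}.
Context {Delta : {mfun Omega >-> d.-tuple R}} {D : set (d.-tuple R)}.
Context {phi : nat -> mpoly.mpoly d R} {n m : nat}.
Context {A : d.-tuple R -> 'M[R]_n} {B : d.-tuple R -> 'M[R]_(n, m)}.
Context {Q : 'M[R]_n} {Rw : 'M[R]_m}.
Hypothesis mD : measurable D.
Hypothesis DD : forall w, D (Delta w).
Hypothesis hphi : orthogonal_basis P Delta D phi.
Hypothesis mA : mx_measurable D A.
Hypothesis mB : mx_measurable D B.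

(** Test with [xi = 1_E u], where [E] is an event on which the form at [u] is nonnegative and
    bounded. The integrand is then nonnegative with nonpositive expectation, hence almost surely
    zero. *)
Lemma matrix_inequality_ae Y W :
  mx_measurable D Y -> mx_measurable D W -> (forall v, D v -> (Y v)^T = Y v) ->
  matrix_inequality P Delta D phi A B Q Rw Y W ->
  {ae P, forall w, forall u, bil (lmi A B Q Rw Y W (Delta w)) u u <= 0}.
Proof.
move=> mY mW Ys [_ MI].
suff h u : {ae P, forall w, bil (lmi A B Q Rw Y W (Delta w)) u u <= 0}.
  have : {ae P, forall w, forall k, bil (lmi A B Q Rw Y W (Delta w))
      (rat_vec n k) (rat_vec n k) <= 0} by apply: ae_foralln => k; exact: h.
  by apply: filterS => w; exact: rat_vec_dense.
pose s v := bil (state_mx A B Q Y W v) u u; pose c v := bil (control_mx Rw W v) u u.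
have ms : measurable_fun D s.
  by apply: measurable_bil; [exact: measurable_state_mx|exact: mx_measurable_cst..].
have mc : measurable_fun D c.
  by apply: measurable_bil; [exact: measurable_control_mx|exact: mx_measurable_cst..].
(* The two parts are bounded separately because the constraint speaks only of processes for which
   both expectations exist. *)
pose E k := [set v | D v /\ [/\ 0 <= s v + c v, `|s v| <= k%:R & `|c v| <= k%:R]].
have mE k : measurable (E k).
  rewrite (_ : E k = (D `&` [set v | 0 <= s v + c v]) `&`
    ((D `&` [set v | `|s v| <= k%:R]) `&` (D `&` [set v | `|c v| <= k%:R]))).
    apply: measurableI; last apply: measurableI; apply: measurable_fun_le => //.
    - exact: measurable_funD.
    - exact: measurableT_comp.
    - exact: measurableT_comp.
  apply/seteqP; split=> [v [Dv []] //|v [[Dv ?] [[_ ?] [_ ?]]]]; by split.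
suff hE k : {ae P, forall w, \1_(E k) (Delta w) * (s (Delta w) + c (Delta w)) = 0}.
  have := ae_foralln hE; apply: filterS => w h; rewrite lmiE bilDm -/(s _) -/(c _).
  rewrite leNgt; apply/negP => sc0.
  pose k := (Num.truncn (`|s (Delta w)| + `|c (Delta w)|)).+1.
  have := h k; rewrite indicE mem_set ?mul1r; first by move=> z0; move: sc0; rewrite z0 ltxx.
  have kP : `|s (Delta w)| + `|c (Delta w)| <= k%:R by exact/ltW/truncnS_gt.
  split; [exact: DD|split; first exact: ltW].
    by rewrite (le_trans _ kP) // lerDl.
  by rewrite (le_trans _ kP) // lerDr.
pose xi v : 'cV[R]_n := \1_(E k) v *: u.
have mxi : mx_measurable D xi.
  move=> i j; under eq_fun do rewrite mxE; apply: measurable_funM.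
    exact: measurable_indic.
  exact: measurable_cst.
have indE v : \1_(E k) v * \1_(E k) v = \1_(E k) v :> R.
  by rewrite indicE; case: (v \in _); rewrite ?mul1r ?mul0r.
have [z zxi] : exists z, second_order_process P Delta D phi z xi.
  apply: (second_order_exists hphi) => a; split; first exact: mxi.
  rewrite /expect unlock; apply: integrable_lty => //.
  apply: (@bounded_integrable _ _ _ _ _ (u a 0 ^+ 2)).
    apply: (@measurable_comp_Delta _ _ _ _ _ _ mD DD (fun v => xi v a 0 ^+ 2)).
    by apply: measurable_funX; exact: mxi.
  move=> w /=; rewrite ger0_norm ?sqr_ge0 // mxE exprMn expr2 indE indicE.
  by case: (_ \in _); rewrite ?mul1r // mul0r sqr_ge0.
have seta := random_series_mul mD DD hphi mY zxi.
have szeta := random_series_mul mD DD hphi mW zxi.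
pose g1 w := \1_(E k) (Delta w) * s (Delta w).
pose g2 w := \1_(E k) (Delta w) * c (Delta w).
have bilxi M v : bil M (xi v) (xi v) = \1_(E k) v * bil M u u.
  by rewrite bilZl bilZr mulrA indE.
have e1 : state_form A B Q xi (fun v => Y v *m xi v) (fun v => W v *m xi v) \o Delta = g1.
  by apply/funext => w /=; rewrite (@state_formE _ _ _ _ _ _ _ Y W) //; exact/Ys/DD.
have e2 : control_form Rw (fun v => W v *m xi v) \o Delta = g2.
  by apply/funext => w /=; rewrite (@control_formE _ _ _ _ _ W xi) // bilxi.
have mg1 : measurable_fun setT g1.
  apply: (@measurable_comp_Delta _ _ _ _ _ _ mD DD (fun v => \1_(E k) v * s v)).
  by apply: measurable_funM => //; exact: measurable_indic.
have mg2 : measurable_fun setT g2.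
  apply: (@measurable_comp_Delta _ _ _ _ _ _ mD DD (fun v => \1_(E k) v * c v)).
  by apply: measurable_funM => //; exact: measurable_indic.
have ig1 : P.-integrable setT (EFin \o g1).
  apply: (@bounded_integrable _ _ _ _ _ k%:R) => // w.
  rewrite /g1 indicE; case: (boolP (Delta w \in E k)); rewrite ?mul1r ?mul0r ?normr0 //.
  by rewrite inE => -[_ []].
have ig2 : P.-integrable setT (EFin \o g2).
  apply: (@bounded_integrable _ _ _ _ _ k%:R) => // w.
  rewrite /g2 indicE; case: (boolP (Delta w \in E k)); rewrite ?mul1r ?mul0r ?normr0 //.
  by rewrite inE => -[_ []].
have := MI z xi _ _ zxi seta szeta.
rewrite /has_expect /expect e1 e2 => /(_ ig1 ig2); rewrite unlock.
rewrite -integralD // => ile.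
suff : {ae P, forall w, g1 w + g2 w = 0}.
  by apply: filterS => w; rewrite /g1 /g2 -mulrDr.
apply: ge0_expectation_le0 => //; first exact: measurable_funD.
move=> w; rewrite -mulrDr indicE; case: (boolP (Delta w \in E k)); rewrite ?mul1r ?mul0r //.
by rewrite inE => -[_ []].
Qed.

End Optimality.

(** * Maximality of the trace against changes on an event *)

Lemma entry_le_abs_sum {R : realFieldType} p q (M : 'M[R]_(p, q)) i j :
  `|M i j| <= abs_sum M.
Proof.
rewrite /abs_sum (bigD1 i) //= (bigD1 j) //= -addrA lerDl addr_ge0 ?sumr_ge0 //.
by move=> k _; rewrite sumr_ge0.
Qed.

Lemma measurable_abs_sum {R : realType} {d p q : nat} (E : set (d.-tuple R))
    (M : d.-tuple R -> 'M[R]_(p, q)) :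
  mx_measurable E M -> measurable_fun E (fun v => abs_sum (M v)).
Proof.
move=> mM; apply: measurable_sum => i; apply: measurable_sum => j.
by apply: measurableT_comp => //; exact: mM.
Qed.

Lemma expectation_le0 {R : realType} {dO : measure_display}
    {Omega : measurableType dO} (P : probability Omega R) (g : Omega -> R) :
  P.-integrable setT (EFin \o g) -> {ae P, forall w, g w <= 0} ->
  (\int[P]_w (g w)%:E <= 0)%E.
Proof.
move=> ig g0; have mg := measurable_int P ig.
rewrite -oppe_ge0 -(integralN (integrable_add_def measurableT ig)).
have -> : (\int[P]_w (- (g w)%:E) = \int[P]_w `|(g w)%:E|)%E.
  apply: ae_eq_integral => //.
  - exact: measurableT_comp.
  - exact: measurableT_comp.
  - by apply: filterS g0 => w gw _ /=; rewrite ler0_norm.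
exact: integral_ge0.
Qed.

Section Improvement.
Context {R : realType} {dO : measure_display} {Omega : measurableType dO}.
Context {P : probability Omega R} {d : nat}.
Context {Delta : {mfun Omega >-> d.-tuple R}} {D : set (d.-tuple R)}.
Context {phi : nat -> mpoly.mpoly d R} {n m : nat}.
Context {A : d.-tuple R -> 'M[R]_n} {B : d.-tuple R -> 'M[R]_(n, m)}.
Context {Q : 'M[R]_n} {Rw : 'M[R]_m}.
Hypothesis mD : measurable D.
Hypothesis DD : forall w, D (Delta w).
Hypothesis hphi : orthogonal_basis P Delta D phi.
Hypothesis mA : mx_measurable D A.
Hypothesis mB : mx_measurable D B.

Lemma le_has_expect (g h : d.-tuple R -> R) : measurable_fun D g ->
  (forall v, D v -> `|g v| <= `|h v|) -> has_expect P Delta h ->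
  has_expect P Delta g.
Proof.
move=> mg gh ih; apply: (@le_integrable _ _ _ _ _ _ _ (EFin \o (h \o Delta))) => //.
  by apply/measurable_EFinP; exact: (measurable_comp_Delta mD DD mg).
by move=> w _ /=; rewrite lee_fin gh.
Qed.

Lemma has_expectD (g h : d.-tuple R -> R) : has_expect P Delta g ->
  has_expect P Delta h -> has_expect P Delta (fun v => g v + h v).
Proof. by move=> ig ih; exact: (integrableD _ ig ih). Qed.

Lemma has_expect_norm (g : d.-tuple R -> R) : has_expect P Delta g ->
  has_expect P Delta (fun v => `|g v|).
Proof. by move=> ig; exact: (integrable_abse ig). Qed.

Lemma has_expectZ k (g : d.-tuple R -> R) : has_expect P Delta g ->
  has_expect P Delta (fun v => k * g v).
Proof. by move=> ig; exact: (integrableZl _ k ig). Qed.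

Lemma has_expect_cst (k : R) : has_expect P Delta (fun=> k).
Proof. exact: finite_measure_integrable_cst. Qed.

Lemma has_expect_sqr (g : d.-tuple R -> R) :
  square_integrable P Delta D g -> has_expect P Delta (fun v => g v ^+ 2).
Proof.
move=> [mg ig]; apply/integrableP; split.
  apply/measurable_EFinP.
  by apply: (measurable_comp_Delta mD DD (g := fun v => g v ^+ 2)); exact: measurable_funX.
move: ig; rewrite /expect unlock; under [X in _ -> (X < _)%E]eq_integral => w _.
  rewrite gee0_abs; last by rewrite lee_fin sqr_ge0.
  over.
by [].
Qed.

Lemma has_expect_poly2 i j :
  has_expect P Delta (fun v => poly_fun (phi i) v * poly_fun (phi j) v).
Proof.
have [sq _ _ _] := hphi.
apply: (@le_has_expect _ (fun v => poly_fun (phi i) v ^+ 2 + poly_fun (phi j) v ^+ 2)).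
- by apply: measurable_funM; exact: (measurable_poly_fun hphi).
- move=> v _; set a := poly_fun _ _; set b := poly_fun _ _.
  rewrite (ger0_norm (addr_ge0 (sqr_ge0 _) (sqr_ge0 _))) ler_norml.
  have := sqr_ge0 (a + b); have := sqr_ge0 (a - b).
  by move=> *; apply/andP; split; nra.
- by apply: has_expectD; exact: has_expect_sqr.
Qed.

(** The replaced part is dominated by a multiple of [f], the kept part by the old integrand. With
    [f = phi_i phi_j] this gives the blocks of a truncated pair. *)
Lemma mx_has_expect_if p q (f : d.-tuple R -> R) (b : d.-tuple R -> bool) k
    (M N : d.-tuple R -> 'M[R]_(p, q)) :
  mx_measurable D (fun v => if b v then M v else N v) -> measurable_fun D f ->
  (forall v, D v -> b v -> abs_sum (M v) <= k) ->
  has_expect P Delta f -> mx_has_expect P Delta (fun v => f v *: N v) ->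
  mx_has_expect P Delta (fun v => f v *: (if b v then M v else N v)).
Proof.
move=> mMN mf Mk iff iN i j.
apply: (@le_has_expect _ (fun v => `|k| * `|f v| + `|f v * N v i j|)).
- under eq_fun do rewrite mxE; apply: measurable_funM => //; exact: mMN.
- move=> v Dv; rewrite mxE [leRHS]ger0_norm; last by rewrite addr_ge0 // mulr_ge0.
  case: ifPn => bv; last by rewrite lerDr mulr_ge0.
  rewrite normrM mulrC ler_wpDr // ler_wpM2r //.
  by rewrite (le_trans (entry_le_abs_sum _ _ _)) // (le_trans (Mk v Dv bv)) // ler_norm.
- apply: has_expectD; first by apply: has_expectZ; exact: has_expect_norm.
  apply: has_expect_norm; have := iN i j; rewrite /has_expect.
  by congr (P.-integrable _ _); apply/funext => w; rewrite /= mxE.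
Qed.

Context (Y : d.-tuple R -> 'M[R]_n) (W : d.-tuple R -> 'M[R]_(m, n)).
Hypothesis sol : solves_program P Delta D phi A B Q Rw Y W.

Lemma feasible_lmi_ae :
  {ae P, forall w, forall u, bil (lmi A B Q Rw Y W (Delta w)) u u <= 0}.
Proof.
case: sol => -[mY mW Yp _ MI] _.
by apply: (matrix_inequality_ae mD DD hphi mA mB mY mW) MI => v /Yp[].
Qed.

Lemma tr_mx_expect (M : d.-tuple R -> 'M[R]_n) : mx_has_expect P Delta M ->
  has_expect P Delta (fun v => \tr (M v)) /\
  (\tr (mx_expect P Delta M))%:E = (\int[P]_w (\tr (M (Delta w)))%:E)%E.
Proof.
move=> iM; have iMi i : P.-integrable setT (fun w => (M (Delta w) i i)%:E) := iM i i.
split.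
  have := integrable_sum measurableT (index_enum 'I_n) (P := xpredT) (fun i _ => iMi i).
  by congr (P.-integrable _ _); apply/funext => w /=; rewrite sumEFin.
rewrite /mxtrace; under eq_integral do rewrite -sumEFin.
rewrite integral_sum // -sumEFin; apply: eq_bigr => i _.
by rewrite mxE /expect unlock fineK //; apply: integrable_fin_num => //; exact: iMi.
Qed.

Section Bounded.
Context (S : set (d.-tuple R)) (k : R).
Context (Y1 : d.-tuple R -> 'M[R]_n) (W1 : d.-tuple R -> 'M[R]_(m, n)).
Hypothesis mS : measurable S.
Hypothesis SD : S `<=` D.
Hypothesis mY1 : mx_measurable S Y1.
Hypothesis mW1 : mx_measurable S W1.
Hypothesis Y1p : forall v, S v -> pos_def (Y1 v).
Hypothesis lmi1 : forall v, S v -> forall u, bil (lmi A B Q Rw Y1 W1 v) u u <= 0.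
Hypothesis bY : forall v, S v -> abs_sum (Y1 v) <= k.
Hypothesis bS : forall v, S v -> abs_sum (state_mx A B Q Y1 W1 v) <= k.
Hypothesis bC : forall v, S v -> abs_sum (control_mx Rw W1 v) <= k.

Let Y' v := if v \in S then Y1 v else Y v.
Let W' v := if v \in S then W1 v else W v.

Let mxin p q (M N : d.-tuple R -> 'M[R]_(p, q)) :
  mx_measurable S M -> mx_measurable D N ->
  mx_measurable D (fun v => if v \in S then M v else N v).
Proof.
have SE : D `&` [set v | v \in S] = S.
  by apply/seteqP; split=> [v [_ /=]|v Sv]; rewrite /= ?inE //; split=> //; exact: SD.
move=> mM mN; apply: mx_measurable_if => //; last by rewrite SE.
by apply: (measurable_fun_bool true); rewrite -[X in measurable X]/(D `&` [set v | v \in S]) SE.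
Qed.

(** Uniqueness of random series identifies [eta] and [zeta] with [Y' xi] and [W' xi] almost surely;
    the forms then add up to the pointwise matrix at [xi], nonpositive on [S] by [lmi1] and off [S]
    by [feasible_lmi_ae]. *)
Let feasible' : feasible P Delta D phi A B Q Rw Y' W'.
Proof.
case: sol => -[mY mW Yp iY [MI1 MI2]] _.
have mY' : mx_measurable D Y' by exact: mxin.
have mW' : mx_measurable D W' by exact: mxin.
have Y'p v : D v -> pos_def (Y' v).
  by move=> Dv; rewrite /Y'; case: ifPn => [|_]; [rewrite inE; exact: Y1p|exact: Yp].
have mAS : mx_measurable S A by exact: mx_measurableS mA.
have mBS : mx_measurable S B by exact: mx_measurableS mB.
split=> //.
(* The weight 1 yields the integrability of [Y'] itself. *)
- have := @mx_has_expect_if _ _ (cst 1) (fun v => v \in S) k Y1 Y mY'.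
  under [X in mx_has_expect _ _ X -> _]eq_fun do rewrite scale1r.
  under [X in _ -> mx_has_expect _ _ X]eq_fun do rewrite scale1r.
  apply => //; first by move=> v _; rewrite inE; exact: bY.
  exact: has_expect_cst.
split.
- move=> i j; have mpp : measurable_fun D (fun v => poly_fun (phi i) v * poly_fun (phi j) v).
    by apply: measurable_funM; exact: (measurable_poly_fun hphi).
  split.
  + rewrite (_ : state_block _ _ _ _ _ _ _ _ = fun v =>
        (poly_fun (phi i) v * poly_fun (phi j) v) *:
        (if v \in S then state_mx A B Q Y1 W1 v else state_mx A B Q Y W v)); last first.
      apply/funext => v; rewrite state_blockE /state_mx /Y' /W'; by case: ifP.
    apply: (@mx_has_expect_if _ _ _ _ k) => //.
    * by apply: mxin; exact: measurable_state_mx.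
    * by move=> v _; rewrite inE; exact: bS.
    * exact: has_expect_poly2.
    * have [+ _] := MI1 i j; congr mx_has_expect.
      by apply/funext => v; rewrite state_blockE.
  + rewrite (_ : control_block _ _ _ _ _ = fun v =>
        (poly_fun (phi i) v * poly_fun (phi j) v) *:
        (if v \in S then control_mx Rw W1 v else control_mx Rw W v)); last first.
      apply/funext => v; rewrite control_blockE /control_mx /W'; by case: ifP.
    apply: (@mx_has_expect_if _ _ _ _ k) => //.
    * by apply: mxin; exact: measurable_control_mx.
    * by move=> v _; rewrite inE; exact: bC.
    * exact: has_expect_poly2.
    * have [_ +] := MI1 i j; congr mx_has_expect.
      by apply/funext => v; rewrite control_blockE.
move=> z xi eta zeta zxi seta szeta ise ice.
rewrite /expect unlock -integralD //.
have etaE := random_series_unique mD DD hphi mY' seta (random_series_mul mD DD hphi mY' zxi).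
have zetaE := random_series_unique mD DD hphi mW' szeta (random_series_mul mD DD hphi mW' zxi).
have h0 : {ae P, forall w, state_form A B Q xi eta zeta (Delta w)
    + control_form Rw zeta (Delta w) <= 0}.
  apply: filterS3 etaE zetaE feasible_lmi_ae => w eE zE lw.
  rewrite (@state_formE _ _ _ _ _ _ _ Y' W') //; last by case: (Y'p _ (DD w)).
  rewrite (@control_formE _ _ _ _ _ W' xi) // -bilDm.
  have -> : state_mx A B Q Y' W' (Delta w) + control_mx Rw W' (Delta w) =
    if Delta w \in S then lmi A B Q Rw Y1 W1 (Delta w) else lmi A B Q Rw Y W (Delta w).
    by rewrite !lmiE /state_mx /control_mx /Y' /W'; case: ifP.
  by case: ifPn => [|_]; [rewrite inE => /lmi1|]; exact.
apply: (@expectation_le0 _ _ _ _ (fun w => state_form A B Q xi eta zeta (Delta w)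
    + control_form Rw zeta (Delta w))) => //; exact: (integrableD _ ise ice).
Qed.

(** The gain in trace is nonnegative everywhere and positive on [S], but maximality makes its
    expectation nonpositive. *)
Lemma improvement_bounded_ae : (forall v, S v -> \tr (Y v) < \tr (Y1 v)) ->
  {ae P, forall w, ~ S (Delta w)}.
Proof.
move=> trS; case: sol => -[mY _ _ iY _] /(_ _ _ feasible').
have [_ _ _ iY' _] := feasible'.
have [itY trY] := tr_mx_expect iY; have [itY' trY'] := tr_mx_expect iY'.
rewrite -lee_fin trY trY' => le_tr.
pose g w := \tr (Y' (Delta w)) - \tr (Y (Delta w)).
have g0 w : 0 <= g w.
  rewrite /g /Y' subr_ge0; case: ifPn => //; rewrite inE => /trS; exact: ltW.
have mg : measurable_fun setT g.
  by apply/measurable_EFinP; exact: (measurable_int P (integrableB _ itY' itY)).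
have : {ae P, forall w, g w = 0}.
  apply: ge0_expectation_le0 => //.
  rewrite (integralB _ itY' itY) //; rewrite leeBlDr ?add0e //.
  exact: integrable_fin_num itY.
apply: filterS => w gw0 Sw; have := trS _ Sw; rewrite -subr_gt0.
by move: gw0; rewrite /g /Y' mem_set // => ->; rewrite ltxx.
Qed.

End Bounded.

Lemma improvement_ae (S : set (d.-tuple R)) (Y1 : d.-tuple R -> 'M[R]_n)
    (W1 : d.-tuple R -> 'M[R]_(m, n)) :
  measurable S -> S `<=` D -> mx_measurable S Y1 -> mx_measurable S W1 ->
  (forall v, S v -> pos_def (Y1 v)) ->
  (forall v, S v -> forall u, bil (lmi A B Q Rw Y1 W1 v) u u <= 0) ->
  {ae P, forall w, S (Delta w) -> \tr (Y1 (Delta w)) <= \tr (Y (Delta w))}.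
Proof.
move=> mS SD mY1 mW1 Y1p lmi1.
have mY : mx_measurable S Y by apply: (mx_measurableS mD SD); case: sol => -[].
pose b v := abs_sum (Y1 v) + abs_sum (state_mx A B Q Y1 W1 v)
  + abs_sum (control_mx Rw W1 v).
have mb : measurable_fun S b.
  apply: measurable_funD; first apply: measurable_funD; apply: measurable_abs_sum => //.
    by apply: measurable_state_mx => //; exact: mx_measurableS mA + exact: mx_measurableS mB.
  exact: measurable_control_mx.
(* Cut down to where the new pair is bounded by [k] and strictly improves the trace; each [T k] is
   null, and together they cover every strict improvement in [S]. *)
pose T k := (S `&` [set v | b v <= k%:R]) `&` (S `&` [set v | \tr (Y v) < \tr (Y1 v)]).
have TS k : T k `<=` S by move=> v [[]].
have mT k : measurable (T k).
  apply: measurableI; first exact: measurable_fun_le.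
  exact: (measurable_fun_ltr (measurable_tr mY) (measurable_tr mY1) mS (Y := [set true])).
have Tae k : {ae P, forall w, ~ T k (Delta w)}.
  have mTS p q (M : d.-tuple R -> 'M[R]_(p, q)) : mx_measurable S M ->
    mx_measurable (T k) M by exact: mx_measurableS.
  have le3 (x y z : R) : 0 <= x -> 0 <= y -> 0 <= z -> x + y + z <= k%:R ->
    [/\ x <= k%:R, y <= k%:R & z <= k%:R] by move=> ? ? ? ?; split; lra.
  have bT v : T k v -> [/\ abs_sum (Y1 v) <= k%:R,
      abs_sum (state_mx A B Q Y1 W1 v) <= k%:R & abs_sum (control_mx Rw W1 v) <= k%:R].
    by move=> [[_ +] _]; apply: le3; exact: abs_sum_ge0.
  apply: (@improvement_bounded_ae _ k%:R Y1 W1) => //.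
  - by move=> v /TS/SD.
  - exact: mTS.
  - exact: mTS.
  - by move=> v /TS/Y1p.
  - by move=> v /TS/lmi1.
  - by move=> v /bT[].
  - by move=> v /bT[].
  - by move=> v /bT[].
  - by move=> v [_ []].
have := ae_foralln Tae; apply: filterS => w h Sw; rewrite leNgt; apply/negP => ltw.
apply: (h (Num.truncn (b (Delta w))).+1); do 2 split => //.
exact/ltW/truncnS_gt.
Qed.

End Improvement.

(** * Linear differential equations and their cost *)

Section LinearODE.
Context {R : realType} {n : nat} (M : 'M[R]_n).

Implicit Types (y : 'cV[R]_n) (t : R) (i : 'I_n).

(** Coordinate [i] of the power series of [exp(t M) y]; taken coordinatewise, it is a scalar series
    that can be differentiated termwise. *)
Definition ode_coeff (y : 'cV[R]_n) (i : 'I_n) (k : nat) : R :=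
  iter k (mulmx M) y i 0 / k`!%:R.

Definition ode_sol (y : 'cV[R]_n) (t : R) : 'cV[R]_n :=
  \col_i limn (pseries (ode_coeff y i) t).

Lemma ode_coeff_diffs y i :
  pseries_diffs (ode_coeff y i) = ode_coeff (M *m y) i.
Proof.
apply/funext => k; rewrite /pseries_diffs /ode_coeff iterSr factS natrM.
by rewrite invfM mulrCA mulVKf ?pnatr_eq0 // mulrC.
Qed.

Lemma iter_mulmx_bound y k i :
  `|iter k (mulmx M) y i 0| <= abs_sum M ^+ k * abs_sum y.
Proof.
elim: k i => [|k ih] i; first by rewrite mul1r entry_le_abs_sum.
rewrite iterS mxE (le_trans (ler_norm_sum _ _ _)) // exprS -mulrA.
apply: (@le_trans _ _ ((\sum_j `|M i j|) * (abs_sum M ^+ k * abs_sum y))).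
  by rewrite mulr_suml ler_sum // => j _; rewrite normrM ler_wpM2l.
rewrite ler_wpM2r ?mulr_ge0 ?exprn_ge0 ?abs_sum_ge0 //.
by rewrite [leRHS](bigD1 i) //= lerDl sumr_ge0 // => j _; rewrite sumr_ge0.
Qed.

Lemma is_cvg_ode y i t : cvgn (pseries (ode_coeff y i) t).
Proof.
apply: normed_cvg; rewrite /=.
pose v k := abs_sum y * exp_coeff (abs_sum M * `|t|) k.
apply: (@series_le_cvg _ _ v).
- by move=> k; exact: normr_ge0.
- move=> k; apply: mulr_ge0; first exact: abs_sum_ge0.
  by apply: exp_coeff_ge0; rewrite mulr_ge0 // abs_sum_ge0.
- move=> k; rewrite /v /exp_coeff /ode_coeff /= !normrM normrX normfV.
  rewrite (ger0_norm (ler0n _ _)) exprMn mulrAC mulrA ler_wpM2r ?invr_ge0 //.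
  by rewrite mulrA ler_wpM2r ?exprn_ge0 // mulrC iter_mulmx_bound.
have -> : series v = fun k => abs_sum y * series (exp_coeff (abs_sum M * `|t|)) k.
  by apply/funext => k; rewrite /series /= mulr_sumr.
by apply: is_cvgMr; exact: is_cvg_series_exp_coeff.
Qed.

Lemma ode_sol0 y : ode_sol y 0 = y.
Proof.
apply/matrixP => i j; rewrite ord1 mxE; apply: cvg_lim => //.
rewrite -cvg_shiftS /=; rewrite (_ : (fun k => _) = cst (y i 0)); first exact: cvg_cst.
apply/funext => k; rewrite /pseries /series /= big_nat_recl //= expr0 mulr1.
rewrite big1 ?addr0; last by move=> l _; rewrite exprS mul0r mulr0.
by rewrite /ode_coeff /= fact0 divr1.
Qed.

Lemma ode_solM y t : ode_sol (M *m y) t = M *m ode_sol y t.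
Proof.
apply/matrixP => i j; rewrite ord1 !mxE; apply: cvg_lim => //.
have -> : pseries (ode_coeff (M *m y) i) t =
    fun k => \sum_l M i l * pseries (ode_coeff y l) t k.
  apply/funext => k; rewrite /pseries /series /=.
  under [RHS]eq_bigr do rewrite mulr_sumr; rewrite exchange_big /=.
  apply: eq_bigr => l _; rewrite /ode_coeff -iterSr iterS mxE !mulr_suml.
  by apply: eq_bigr => p _; rewrite !mulrA.
by apply: cvgr_sum => l; apply: cvgMr; rewrite mxE; exact: is_cvg_ode.
Qed.

Lemma is_derive_ode_sol y t :
  is_derive t 1 (ode_sol y) (M *m ode_sol y t).
Proof.
have dx i : is_derive t 1 (fun s => ode_sol y s i 0) ((M *m ode_sol y t) i 0).
  rewrite -ode_solM mxE -ode_coeff_diffs.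
  under eq_fun do rewrite mxE.
  (* Termwise differentiation asks for convergence beyond [|t|] of the series and its first two
     formal derivatives; these are the series of [y], [M y] and [M (M y)], which converge
     everywhere. *)
  apply: (@pseries_snd_diffs _ _ (`|t| + 1)); rewrite ?ode_coeff_diffs;
    try exact: is_cvg_ode.
  by rewrite [ltRHS]ger0_norm ?addr_ge0 // ltrDl.
have dxm : derivable (ode_sol y) t 1.
  by apply/derivable_mxP => i j; rewrite ord1; exact: (@ex_derive _ _ _ _ _ _ _ (dx i)).
apply: DeriveDef => //; rewrite derive_mx //; apply/matrixP => i j.
by rewrite mxE ord1; exact: (@derive_val _ _ _ _ _ _ _ (dx i)).
Qed.

End LinearODE.

Lemma cvg_bil {R : realType} {n : nat} (L : 'M[R]_n) (T : Type)
    (H : set_system T) {FF : Filter H} (x : T -> 'cV[R]_n) (l : 'cV[R]_n) :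
  x @ H --> l -> bil L (x t) (x t) @[t --> H] --> bil L l l.
Proof.
move=> xl; have xi i : (fun t => x t i 0) @ H --> l i 0.
  exact: (continuous_cvg _ (@coord_continuous R n 1 i 0 l) xl).
rewrite bilE; under eq_cvg do rewrite bilE.
apply: cvgr_sum => i; apply: cvgr_sum => j; apply: cvgMr; exact: cvgM.
Qed.

Lemma is_derive_bil {R : realType} {n : nat} (L : 'M[R]_n)
    (x : R -> 'cV[R]_n) (dx : 'cV[R]_n) (t : R) : L^T = L ->
  is_derive t 1 x dx ->
  is_derive t 1 (fun s => bil L (x s) (x s)) (2 * bil L (x t) dx).
Proof.
move=> Ls xdx; have dxi i : is_derive t 1 (fun s => x s i 0) (dx i 0).
  have dm : derivable x t 1 by exact: ex_derive.
  apply: DeriveDef; first by move/derivable_mxP : dm => /(_ i 0).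
  by rewrite -(@derive_val _ _ _ _ _ _ _ xdx) derive_mx // mxE.
rewrite (_ : (fun s => _) = \sum_i \sum_j (cst (L i j) *
    ((fun s => x s i 0) * (fun s => x s j 0)))); last first.
  apply/funext => s; rewrite bilE fct_sumE; apply: eq_bigr => i _.
  by rewrite fct_sumE.
have h : is_derive t 1 (\sum_i \sum_j (cst (L i j) *
    ((fun s => x s i 0) * (fun s => x s j 0)))) (\sum_i \sum_j (L i j *
    (x t i 0 * dx j 0 + x t j 0 * dx i 0))).
  apply: is_derive_sum => i; apply: is_derive_sum => j.
  by apply: is_derive_eq; rewrite /= scaler0 addr0.
apply: (is_derive_eq h).
under eq_bigr do under eq_bigr do rewrite mulrDr.
under eq_bigr do rewrite big_split /=.
rewrite big_split /= [X in _ + X]exchange_big /= mulr_natl mulr2n bilE; congr (_ + _).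
by apply: eq_bigr => i _; apply: eq_bigr => j _; rewrite -{1}Ls mxE.
Qed.

Lemma is_derive_affine_comb {R : realType} (f g : R -> R) (df dg t c : R) :
  is_derive t 1 f df -> is_derive t 1 g dg ->
  is_derive t 1 (fun s => f s + s * (c * g s)) (df + (t * (c * dg) + c * g t)).
Proof.
move=> fdf gdg.
have h := is_deriveD fdf (is_deriveM (is_derive_id t 1) (is_deriveZ c gdg)).
by apply: (@is_derive_eq _ _ _ _ _ _ _ _ h); rewrite /GRing.scale /= mulr1.
Qed.

Arguments is_derive_affine_comb {R f g df dg t} c.

(** * Lyapunov functions and cost along a trajectory *)

Section Trajectory.
Context {R : realType} {n : nat} (x dx : R -> 'cV[R]_n).
Hypothesis cx : {within `[0, +oo[, continuous x}.
Hypothesis dxE : forall t : R, 0 < t -> is_derive t 1 x (dx t).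
Implicit Types (L P M : 'M[R]_n) (y : 'cV[R]_n) (t : R).

Lemma within_bil L : {within `[0, +oo[, continuous (fun t => bil L (x t) (x t))}.
Proof. by move=> t; apply: cvg_bil; exact: cx. Qed.

Lemma derivable_bil L t : L^T = L -> 0 < t ->
  derivable (fun s => bil L (x s) (x s)) t 1.
Proof. by move=> Ls t0; exact: (@ex_derive _ _ _ _ _ _ _ (is_derive_bil Ls (dxE t0))). Qed.

Lemma derive1_bil L t : L^T = L -> 0 < t ->
  derive1 (fun s => bil L (x s) (x s)) t = 2 * bil L (x t) (dx t).
Proof.
move=> Ls t0; rewrite derive1E.
exact: (@derive_val _ _ _ _ _ _ _ (is_derive_bil Ls (dxE t0))).
Qed.

Lemma cvg_vec0 P : pos_def P ->
  (fun t => bil P (x t) (x t)) @ +oo --> (0 : R) -> x @ +oo --> (0 : 'cV[R]_n).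
Proof.
move=> Pp xP; apply/cvgr0Pnorm_le => e e0.
(* The [+ 1] keeps [k] positive in dimension 0. *)
pose k := abs_sum (invmx P) + 1.
have k0 : 0 < k by rewrite ltr_wpDl ?abs_sum_ge0.
apply: filterS (cvgr0_norm_le _ xP _ (divr_gt0 (exprn_gt0 2 e0) k0)) => t.
rewrite ger0_norm ?pos_def_ge0 // ler_pdivlMr // => ht.
rewrite /Num.Def.normr/= mx_normrE (bigmax_le _ (ltW e0))//= => -[i j] _.
rewrite ord1 /= -(@ler_pXn2r _ 2) ?nnegrE ?(ltW e0) //.
rewrite real_normK ?num_real // (le_trans (sqr_coord_le _ _)) //.
rewrite (le_trans (norm_le_pos_def _ Pp)) // (le_trans _ ht) // mulrC.
by rewrite ler_wpM2l ?pos_def_ge0 // lerDl.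
Qed.

(* [q_L(x) + t q_P(x) / 4] is nonincreasing, so [q_P(x) = O(1 / t)]. *)
Lemma lyapunov_cvg0 P L : pos_def P -> L^T = L -> (forall y, 0 <= bil L y y) ->
  (forall t, 0 < t -> bil P (x t) (dx t) <= 0) ->
  (forall t, 0 < t -> 2 * bil L (x t) (dx t) <= - (4^-1 * bil P (x t) (x t))) ->
  x @ +oo --> (0 : 'cV[R]_n).
Proof.
move=> Pp Ls L0 Pdx Ldx; apply: (cvg_vec0 Pp).
pose H t := bil L (x t) (x t) + t * (4^-1 * bil P (x t) (x t)).
have dH t : 0 < t -> is_derive t 1 H (2 * bil L (x t) (dx t)
    + (t * (4^-1 * (2 * bil P (x t) (dx t))) + 4^-1 * bil P (x t) (x t))).
  move=> t0; have h := is_derive_affine_comb 4^-1 (is_derive_bil Ls (dxE t0))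
    (is_derive_bil (proj1 Pp) (dxE t0)).
  exact: h.
have Hle t : 0 <= t -> H t <= bil L (x 0) (x 0).
  move=> t0; have -> : bil L (x 0) (x 0) = H 0 by rewrite /H mul0r addr0.
  apply: (@ler0_derive1_nincry _ H 0) => //.
  - move=> s; rewrite in_itv /= andbT => s0; exact: (@ex_derive _ _ _ _ _ _ _ (dH s s0)).
  - move=> s; rewrite in_itv /= andbT => s0; rewrite derive1E.
    rewrite (@derive_val _ _ _ _ _ _ _ (dH s s0)).
    have h : s * bil P (x s) (dx s) <= 0 by rewrite pmulr_rle0 ?Pdx.
    have := Ldx s s0; lra.
  - move=> s; apply: cvgD; first exact: within_bil.
    apply: cvgM; first by apply: continuous_subspaceT => z; exact: cvg_id.
    by apply: cvgMr; exact: within_bil.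
apply: (@squeeze_cvgr _ _ _ _ (cst 0) (fun t => (4 * bil L (x 0) (x 0)) * t^-1)).
- near=> t; rewrite pos_def_ge0 //=.
  have t0 : 0 < t by near: t; exact: nbhs_pinfty_gt.
  rewrite ler_pdivlMr //; have := Hle t (ltW t0); have := L0 (x t); rewrite /H; lra.
- exact: cvg_cst.
- rewrite -[X in _ --> X](mulr0 (4 * bil L (x 0) (x 0))); apply: cvgMr.
  apply/gtr0_cvgV0; first exact: nbhs_pinfty_gt.
  exact: cvg_id.
Unshelve. all: by end_near. Qed.

End Trajectory.

Section TrajectoryCost.
Context {R : realType} {n : nat} (x : R -> 'cV[R]_n) (F P C : 'M[R]_n).
Hypothesis cx : {within `[0, +oo[, continuous x}.
Hypothesis dxE : forall t : R, 0 < t -> is_derive t 1 x (F *m x t).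
Hypothesis Ps : P^T = P.
Hypothesis C0 : forall y, 0 <= bil C y y.

Let Ns : (- P)^T = - P. Proof. by rewrite linearN /= Ps. Qed.

Let cost_ge0 (t : R) : (0%R <= (bil C (x t) (x t))%:E)%E.
Proof. by rewrite lee_fin. Qed.

Let right0 : bil (- P) (x t) (x t) @[t --> 0^'+] --> bil (- P) (x 0) (x 0).
Proof.
have /continuous_within_itvcyP[_ x0] := cx.
exact: cvg_bil x0.
Qed.

Let measurable_cost (I : set R) : measurable I -> I `<=` `[0, +oo[%classic ->
  measurable_fun I (fun t => (bil C (x t) (x t))%:E).
Proof.
move=> mI I0; apply/measurable_EFinP.
apply: (measurable_funS _ I0) => //.
by apply: subspace_continuous_measurable_fun => //; exact: within_bil.
Qed.

(** [- P(x,x)] is a primitive of the running cost and vanishes at infinity. *)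
Lemma trajectory_cost : (forall y, 2 * bil P y (F *m y) + bil C y y = 0) ->
  (fun t => bil P (x t) (x t)) @ +oo --> (0 : R) ->
  (\int[lebesgue_measure]_(t in `[0%R, +oo[) (bil C (x t) (x t))%:E
   = (bil P (x 0) (x 0))%:E)%E.
Proof.
move=> PF P0.
rewrite (@ge0_continuous_FTC2y _ _ (fun t => bil (- P) (x t) (x t)) 0 0) //.
- by rewrite sub0e -EFinN bilNm opprK.
- exact: within_bil.
- have -> : (fun t => bil (- P) (x t) (x t)) = (fun t => - bil P (x t) (x t)).
    by apply/funext => t; rewrite bilNm.
  by have h := cvgN P0; rewrite oppr0 in h; exact: h.
- by move=> t t0; apply: (derivable_bil dxE Ns).
- move=> t; rewrite in_itv /= andbT => t0; rewrite (derive1_bil dxE Ns t0).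
  by have := PF (x t); rewrite bilNm; lra.
Qed.

(** The cost on [[0, T]] is at least [P(x(0),x(0)) - P(x(T),x(T))]; let [T] tend to infinity. *)
Lemma trajectory_cost_ge :
  (forall y, 0 <= 2 * bil P y (F *m y) + bil C y y) ->
  (fun t => bil P (x t) (x t)) @ +oo --> (0 : R) ->
  ((bil P (x 0) (x 0))%:E <=
   \int[lebesgue_measure]_(t in `[0%R, +oo[) (bil C (x t) (x t))%:E)%E.
Proof.
move=> PF P0; set I := (X in (_ <= X)%E).
have le T : 0 < T -> ((bil P (x 0) (x 0) - bil P (x T) (x T))%:E <= I)%E.
  move=> T0; have sub : `[0, T] `<=` `[0, +oo[%classic.
    by move=> t /=; rewrite !in_itv /= andbT => /andP[].
  have cT L : {within `[0, T], continuous (fun t => bil L (x t) (x t))}.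
    exact: continuous_subspaceW sub (within_bil cx (L := L)).
  (* The derivative of [- P(x,x)], written as a quadratic form in [x] so that its continuity up to 0
     is inherited from [x]. *)
  pose f t := bil (- (2 *: (P *m F))) (x t) (x t).
  have fE t : f t = 2 * bil (- P) (x t) (F *m x t).
    by rewrite /f !bilNm bilZm bil_mulr; ring.
  have FTC : (\int[lebesgue_measure]_(t in `[0%R, T]) (f t)%:E
      = (bil (- P) (x T) (x T))%:E - (bil (- P) (x 0) (x 0))%:E)%E.
    apply: (@continuous_FTC2 _ f (fun t => bil (- P) (x t) (x t)) 0 T) => //; first exact: cT.
      split.
      - by move=> t; rewrite in_itv /= => /andP[t0 _]; apply: (derivable_bil dxE Ns).
      - exact: right0.
      - by have /(continuous_within_itvP _ T0)[] := cT (- P).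
    move=> t; rewrite in_itv /= => /andP[t0 _]; rewrite fE.
    by rewrite (derive1_bil dxE Ns t0).
  have -> : ((bil P (x 0) (x 0) - bil P (x T) (x T))%:E =
      \int[lebesgue_measure]_(t in `[0%R, T]) (f t)%:E)%E.
    by rewrite FTC !bilNm -EFinB; congr EFin; ring.
  apply: (@le_trans _ _
    (\int[lebesgue_measure]_(t in `[0%R, T]) (bil C (x t) (x t))%:E)%E).
    apply: le_integral => //.
    + by apply: continuous_compact_integrable; [exact: segment_compact|exact: cT].
    + by apply: continuous_compact_integrable; [exact: segment_compact|exact: cT].
    + by move=> t _; rewrite lee_fin fE bilNm; have := PF (x t); lra.
  by apply: ge0_subset_integral => //; exact: measurable_cost.
have I0 : (0 <= I)%E by apply: integral_ge0.
case: I I0 le => [r|_ _|//]; last by rewrite leey.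
move=> _ le; rewrite lee_fin -[leLHS]subr0.
have h : (fun T => bil P (x 0) (x 0) - bil P (x T) (x T)) @ +oo -->
    bil P (x 0) (x 0) - 0 by apply: cvgB => //; exact: cvg_cst.
have /cvg_lim <- := h => //; apply: limr_le; first by apply/cvg_ex; eexists; exact: h.
by near=> T; rewrite -lee_fin; apply: le; near: T; exact: nbhs_pinfty_gt.
Unshelve. all: by end_near. Qed.

End TrajectoryCost.

(** * Optimality *)

(* Neither side of the two comparisons below needs the function [f] to be
   measurable: the integral of a nonnegative function is a supremum over the
   simple functions below it. *)
Section NonmeasurableIntegral.
Import HBNNSimple.
Context {R : realType} {dO : measure_display} {Omega : measurableType dO}.
Context (P : probability Omega R) (f a : Omega -> \bar R).
Hypothesis f0 : forall w, (0 <= f w)%E.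
Hypothesis a0 : forall w, (0 <= a w)%E.
Hypothesis ma : measurable_fun setT a.

Lemma integral_le_ae : {ae P, forall w, f w <= a w}%E ->
  (\int[P]_w f w <= \int[P]_w a w)%E.
Proof.
move=> fa; rewrite ge0_integralTE //; apply: ge_ereal_sup => _ [h /= hf <-].
rewrite -integralT_nnsfun; apply: ae_ge0_le_integral => //.
- by move=> w _; rewrite lee_fin; exact: fun_ge0.
- by apply/measurable_EFinP; exact: measurable_funP.
- by apply: filterS fa => w fw _; exact: le_trans (hf w) fw.
Qed.

Lemma integral_ge_ae : {ae P, forall w, a w <= f w}%E ->
  (\int[P]_w a w <= \int[P]_w f w)%E.
Proof.
move=> af; rewrite [leRHS]ge0_integralTE //; case: af => N [mN N0 Nsub].
(* Once [a] is cut to 0 on the null set [N], every simple function below it lies below [f]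
   everywhere. *)
rewrite (ge0_negligible_integral mN) // integral_mkcond ge0_integralTE; last first.
  by move=> w; rewrite patchE; case: ifP.
apply: le_ereal_sup => _ [h /= ha <-]; exists h => //= w.
apply: (le_trans (ha w)); rewrite patchE; case: ifPn => //.
rewrite inE => -[_ Nw]; apply: contrapT => h0; apply: Nw; exact: Nsub.
Qed.

End NonmeasurableIntegral.

(** * Measurability of the improved pair *)

Section ImprovedMeasurability.
Context {R : realType} {d : nat} (E : set (d.-tuple R)).
Hypothesis mE : measurable E.

(** A pointwise limit of iterates that are rational in the entries of [F] and [C]; the supersolution
    [P] provides the invertibility of [1 - F] and the convergence. *)
Lemma measurable_policy_value p (F C P : d.-tuple R -> 'M[R]_p) :
  mx_measurable E F -> mx_measurable E C ->
  (forall v, E v -> pos_def (P v)) -> (forall v, E v -> pos_semidef (C v)) ->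
  (forall v, E v -> forall y, 2 * bil (P v) y (F v *m y) + bil (C v) y y <= 0) ->
  mx_measurable E (fun v => policy_value (F v) (C v)).
Proof.
move=> mF mC Pp Cp FC i j.
apply: (measurable_fun_cvg (h := fun k v => stein_iter (F v) (C v) k i j)); last first.
  by move=> v Ev; exact: (stein_iter_cvg (Pp v Ev) (Cp v Ev) (FC v Ev)).
have mJ : mx_measurable E (fun v => resolvent (F v)).
  apply: mx_measurable_inv => //.
    by apply: mx_measurableD; [exact: mx_measurable_cst|exact: mx_measurableN].
  by move=> v Ev; exact: (resolvent_unit (Pp v Ev) (Cp v Ev) (FC v Ev)).
have mU : mx_measurable E (fun v => cayley (F v)).
  by apply: mx_measurableM => //; apply: mx_measurableD => //; exact: mx_measurable_cst.
move=> k; suff : mx_measurable E (fun v => stein_iter (F v) (C v) k) by exact.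
elim: k => [|k ih] /=; first exact: mx_measurable_cst.
apply: mx_measurableD.
  apply: mx_measurableZ; apply: mx_measurableM => //; apply: mx_measurableM => //.
  exact: mx_measurable_tr.
apply: mx_measurableM => //; apply: mx_measurableM => //; exact: mx_measurable_tr.
Qed.

Context {n m : nat}.
Context (A : d.-tuple R -> 'M[R]_n) (B : d.-tuple R -> 'M[R]_(n, m)).
Context (Q : 'M[R]_n) (Rw : 'M[R]_m).
Context (Y : d.-tuple R -> 'M[R]_n) (W : d.-tuple R -> 'M[R]_(m, n)).
Hypothesis Qp : pos_semidef Q.
Hypothesis Rp : pos_semidef Rw.
Hypothesis mA : mx_measurable E A.
Hypothesis mB : mx_measurable E B.
Hypothesis mY : mx_measurable E Y.
Hypothesis mW : mx_measurable E W.
Hypothesis Yp : forall v, E v -> pos_def (Y v).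
Hypothesis lmi0 : forall v, E v -> forall u, bil (lmi A B Q Rw Y W v) u u <= 0.

Let mP : mx_measurable E (fun v => invmx (Y v)).
Proof. by apply: mx_measurable_inv => // v /Yp; exact: pos_def_unit. Qed.

Lemma measurable_gain : mx_measurable E (fun v => gain (Y v) (W v)).
Proof. exact: mx_measurableM. Qed.

Lemma measurable_improved_gain :
  mx_measurable E (fun v => improved_gain (B v) Rw (Y v) (W v)).
Proof.
apply: mx_measurableD; first exact: measurable_gain.
apply: mx_measurableN; apply: mx_measurableZ; apply: mx_measurableD.
  by apply: mx_measurableM => //; exact: mx_measurable_tr.
by apply: mx_measurableM; [exact: mx_measurable_cst|exact: measurable_gain].
Qed.

Lemma measurable_improved_Y :
  mx_measurable E (fun v => improved_Y (A v) (B v) Q Rw (Y v) (W v)).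
Proof.
have mK := measurable_improved_gain.
have mV : mx_measurable E (fun v => improved_value (A v) (B v) Q Rw (Y v) (W v)).
  apply: (measurable_policy_value (P := fun v => invmx (Y v))).
  - by apply: mx_measurableD => //; exact: mx_measurableM.
  - apply: mx_measurableD; first exact: mx_measurable_cst.
    apply: mx_measurableM => //; apply: mx_measurableM; last exact: mx_measurable_cst.
    exact: mx_measurable_tr.
  - by move=> v /Yp; exact: pos_def_inv.
  - by move=> v _; exact: improved_weight_psd.
  - by move=> v Ev; exact: (improved_lyap Rp (Yp Ev) (lmi0 Ev)).
apply: mx_measurable_inv => //.
  by apply: mx_measurableZ; exact: mx_measurableD.
move=> v Ev; apply: pos_def_unit; apply: pos_def_average.
- exact: pos_def_inv (Yp Ev).
- exact: improved_weight_psd.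
- exact: (improved_lyap Rp (Yp Ev) (lmi0 Ev)).
Qed.

Lemma measurable_improved_W :
  mx_measurable E (fun v => improved_W (A v) (B v) Q Rw (Y v) (W v)).
Proof. exact: mx_measurableM measurable_improved_gain measurable_improved_Y. Qed.

End ImprovedMeasurability.

(** * The closed loop of a solution and its cost *)

Section ClosedLoop.
Context {R : realType} {dO : measure_display} {Omega : measurableType dO}.
Context {P : probability Omega R} {d : nat}.
Context {Delta : {mfun Omega >-> d.-tuple R}} {D : set (d.-tuple R)}.
Context {phi : nat -> mpoly.mpoly d R} {n m : nat}.
Context {A : d.-tuple R -> 'M[R]_n} {B : d.-tuple R -> 'M[R]_(n, m)}.
Context {Q : 'M[R]_n} {Rw : 'M[R]_m}.
Hypothesis mD : measurable D.
Hypothesis DD : forall w, D (Delta w).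
Hypothesis hphi : orthogonal_basis P Delta D phi.
Hypothesis mA : mx_measurable D A.
Hypothesis mB : mx_measurable D B.
Hypothesis Qp : pos_semidef Q.
Hypothesis Rp : pos_semidef Rw.
Context (Y : d.-tuple R -> 'M[R]_n) (W : d.-tuple R -> 'M[R]_(m, n)).
Hypothesis sol : solves_program P Delta D phi A B Q Rw Y W.

Let mY : mx_measurable D Y. Proof. by case: sol => -[]. Qed.
Let mW : mx_measurable D W. Proof. by case: sol => -[]. Qed.
Let Yp v : D v -> pos_def (Y v). Proof. by case: sol => -[] ? ? + *; apply. Qed.

Definition optimal_at (v : d.-tuple R) : Prop :=
  (forall u, bil (lmi A B Q Rw Y W v) u u <= 0) /\
  improved_value (A v) (B v) Q Rw (Y v) (W v) = invmx (Y v).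

(** The improvement step is carried out on the measurable set [G] where the inequality holds
    pointwise, which has full probability. The trace cannot grow there, so [improved_tr] applies. *)
Lemma solution_optimal_ae : {ae P, forall w, optimal_at (Delta w)}.
Proof.
pose G := D `&` [set v | forall u, bil (lmi A B Q Rw Y W v) u u <= 0].
have mG : measurable G by exact: measurable_lmi_nsd.
have GD : G `<=` D by move=> v [].
have mGS p q (M : d.-tuple R -> 'M[R]_(p, q)) : mx_measurable D M -> mx_measurable G M.
  exact: mx_measurableS.
have GYp v : G v -> pos_def (Y v) by move=> /GD/Yp.
have Glmi v : G v -> forall u, bil (lmi A B Q Rw Y W v) u u <= 0 by case.
have tr_le := improvement_ae mD DD hphi mA mB sol
  (Y1 := fun v => improved_Y (A v) (B v) Q Rw (Y v) (W v))
  (W1 := fun v => improved_W (A v) (B v) Q Rw (Y v) (W v)) mG GD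
  (measurable_improved_Y mG Qp Rp (mGS _ _ _ mA) (mGS _ _ _ mB) (mGS _ _ _ mY)
    (mGS _ _ _ mW) GYp Glmi)
  (measurable_improved_W mG Qp Rp (mGS _ _ _ mA) (mGS _ _ _ mB) (mGS _ _ _ mY)
    (mGS _ _ _ mW) GYp Glmi).
have {tr_le} := tr_le (fun v Gv => improved_Y_pos_def Qp Rp (GYp v Gv) (Glmi v Gv))
  (fun v Gv u => improved_lmi Qp Rp (GYp v Gv) (Glmi v Gv) u).
apply: filterS2 (feasible_lmi_ae mD DD hphi mA mB sol) => w lw tr_le.
have Gw : G (Delta w) by split; [exact: DD|].
by split=> //; exact: (improved_tr Qp Rp (GYp _ Gw) (Glmi _ Gw) (tr_le Gw)).
Qed.

Context (x0 : 'cV[R]_n).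

Definition closed_loop_mx (K : d.-tuple R -> 'M[R]_(m, n)) v := A v + B v *m K v.

Definition closed_loop_weight (K : d.-tuple R -> 'M[R]_(m, n)) v :=
  Q + (K v)^T *m Rw *m K v.

Lemma costE K x : cost P Delta Q Rw K x =
  (\int[P]_w \int[lebesgue_measure]_(t in `[0%R, +oo[)
    (bil (closed_loop_weight K (Delta w)) (x t (Delta w)) (x t (Delta w)))%:E)%E.
Proof.
apply: eq_integral => w _; apply: eq_integral => t _; congr EFin.
by rewrite /closed_loop_weight bilDm bil_congr mxE.
Qed.

Lemma closed_loop_weight_ge0 K v y : 0 <= bil (closed_loop_weight K v) y y.
Proof.
by rewrite bilDm bil_congr addr_ge0 //; [exact: (proj2 Qp)|exact: (proj2 Rp)].
Qed.

Lemma hamiltonian_closed_loop K v M y :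
  2 * bil M y (closed_loop_mx K v *m y) + bil (closed_loop_weight K v) y y
  = hamiltonian (A v) (B v) Q Rw M y (K v *m y).
Proof.
by rewrite /closed_loop_mx (mulmxDl (A v)) -(mulmxA (B v)) bilDm bil_congr addrA.
Qed.

Lemma closed_loop_derive K x v (t : R) : closed_loop D A B x0 K x -> D v -> 0 < t ->
  is_derive t 1 (fun s => x s v) (closed_loop_mx K v *m x t v).
Proof.
move=> cl Dv t0; have [_ _ /(_ _ t0)] := cl v Dv.
by rewrite /closed_loop_mx (mulmxDl (A v)) -(mulmxA (B v)).
Qed.

Let K v := gain (Y v) (W v).
Let x (t : R) v := ode_sol (closed_loop_mx K v) x0 t.

Let x_cl : closed_loop D A B x0 K x.
Proof.
move=> v Dv; have dx (t : R) := is_derive_ode_sol (closed_loop_mx K v) x0 t.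
split.
- exact: ode_sol0.
- apply: derivable_within_continuous => t _.
  exact: (@ex_derive _ _ _ _ _ _ _ (dx t)).
- move=> t _.
  have -> : A v *m x t v + B v *m (K v *m x t v) = closed_loop_mx K v *m x t v.
    by rewrite [RHS](mulmxDl (A v)) -(mulmxA (B v)).
  exact: dx.
Qed.

(** The zero Hamiltonian makes [P(x,x)] nonincreasing, and [optimal_lyapunov] supplies the strict
    decrease that a merely semidefinite weight would not. *)
Let x_cvg0 v : D v -> optimal_at v -> x ^~ v @ +oo --> (0 : 'cV[R]_n).
Proof.
move=> Dv [lv opt]; have [_ cx _] := x_cl Dv.
have [L [Ls L0 LF]] := optimal_lyapunov Qp Rp (Yp Dv) lv opt.
apply: (lyapunov_cvg0 cx (dx := fun t => closed_loop_mx K v *m x t v)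
  _ (pos_def_inv (Yp Dv)) Ls L0).
- by move=> t t0; exact: (closed_loop_derive x_cl Dv t0).
- move=> t t0; have := hamiltonian_closed_loop K v (invmx (Y v)) (x t v).
  rewrite (optimal_hamiltonian0 Qp Rp (Yp Dv) lv opt).
  have := closed_loop_weight_ge0 K v (x t v); lra.
- move=> t t0; have := LF (x t v).
  by rewrite /closed_loop_mx (mulmxDl (A v)) -(mulmxA (B v)).
Qed.

Let value w : \bar R := (bil (invmx (Y (Delta w))) x0 x0)%:E.

Let value_ge0 w : (0 <= value w)%E.
Proof. by rewrite lee_fin pos_def_ge0 //; exact/pos_def_inv/Yp. Qed.

Let measurable_value : measurable_fun setT value.
Proof.
apply/measurable_EFinP.
apply: (measurable_comp_Delta mD DD (g := fun v => bil (invmx (Y v)) x0 x0)).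
apply: measurable_bil; [|exact: mx_measurable_cst..].
by apply: mx_measurable_inv => // v /Yp; exact: pos_def_unit.
Qed.

Let cost_opt_le : (cost P Delta Q Rw K x <= \int[P]_w value w)%E.
Proof.
rewrite costE; apply: integral_le_ae => //.
- by move=> w; apply: integral_ge0 => t _; rewrite lee_fin closed_loop_weight_ge0.
apply: filterS solution_optimal_ae => w ow; have Dv := DD w.
have [xw0 cx _] := x_cl Dv; have [lv opt] := ow.
rewrite (trajectory_cost (P := invmx (Y (Delta w))) cx
  (fun t t0 => closed_loop_derive x_cl Dv t0)) ?xw0 //.
- by case: (pos_def_inv (Yp Dv)).
- exact: closed_loop_weight_ge0.
- move=> y; rewrite hamiltonian_closed_loop.
  exact: (optimal_hamiltonian0 Qp Rp (Yp Dv) lv opt).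
- have h := cvg_bil (L := invmx (Y (Delta w))) (x_cvg0 Dv ow).
  by rewrite bil0l in h; exact: h.
Qed.

(** Admissibility enters through the decay of [x']: it removes the terminal term
    [P(x'(T),x'(T))]. *)
Let cost_ge K' x' : admissible P Delta D A B x0 K' x' ->
  (\int[P]_w value w <= cost P Delta Q Rw K' x')%E.
Proof.
move=> [_ cl x'0]; rewrite costE; apply: integral_ge_ae => //.
- by move=> w; apply: integral_ge0 => t _; rewrite lee_fin closed_loop_weight_ge0.
apply: filterS2 solution_optimal_ae x'0 => w [lv opt] x'w0; have Dv := DD w.
have [xw0 cx _] := cl _ Dv; rewrite /value -xw0.
apply: (trajectory_cost_ge (P := invmx (Y (Delta w))) cx
  (fun t t0 => closed_loop_derive cl Dv t0)).
- by case: (pos_def_inv (Yp Dv)).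
- exact: closed_loop_weight_ge0.
- move=> y; rewrite hamiltonian_closed_loop.
  exact: (optimal_hamiltonian_ge0 Qp Rp (Yp Dv) lv opt).
- have h := cvg_bil (L := invmx (Y (Delta w))) x'w0.
  by rewrite bil0l in h; exact: h.
Qed.

Lemma solution_minimizes_cost :
  minimizes_cost P Delta D A B Q Rw x0 (fun v => W v *m invmx (Y v)).
Proof.
exists x; split.
  split; [exact: measurable_gain|exact: x_cl|].
  by apply: filterS solution_optimal_ae => w; exact: x_cvg0.
by move=> K' x' /cost_ge; exact: le_trans.
Qed.

End ClosedLoop.

Theorem theorem2 (R : realType) (dO : measure_display)
  (Omega : measurableType dO) (P : probability Omega R) (d : nat)
  (Delta : {mfun Omega >-> d.-tuple R}) (D : set (d.-tuple R))
  (f : d.-tuple R -> R) (hf : joint_density P Delta D f)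
  (phi : nat -> mpoly.mpoly d R) (hphi : orthogonal_basis P Delta D phi)
  (n m : nat)
  (A : d.-tuple R -> 'M[R]_n) (hA : mx_measurable D A)
  (B : d.-tuple R -> 'M[R]_(n, m)) (hB : mx_measurable D B)
  (Q : 'M[R]_n) (hQ : pos_semidef Q)
  (Rw : 'M[R]_m) (hRw : pos_semidef Rw)
  (x0 : 'cV[R]_n)
  (Y : d.-tuple R -> 'M[R]_n) (W : d.-tuple R -> 'M[R]_(m, n)) :
  solves_program P Delta D phi A B Q Rw Y W ->
  minimizes_cost P Delta D A B Q Rw x0 (fun v => W v *m invmx (Y v)).
Proof.
move=> sol; have [mD DD _ _ _] := hf.
exact: (solution_minimizes_cost mD DD hphi hA hB hQ hRw sol x0).
Qed.
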